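(* The algorithm ''Iterative Refinement for a Primal and Dual Feasible LP'' (defined in the context) with a limited-precision LP oracle runs in oracle-polynomial time, i.e., it requires a polynomial number of oracle calls and a polynomial number of bit operations in the size of the input $A,b,\ell,c,\tau$, when $\tau>0$.
   Context: All logarithms are base two. Encoding length (size): $\langle z\rangle := 1+\lceil\log(|z|+1)\rceil$ for $z\in\mathbb{Z}$; $\langle r/q\rangle:=\langle r\rangle+\langle q\rangle$ for a rational number $r/q$ in lowest terms with $q>0$; the size of a vector or matrix is the sum of the sizes of its entries; the size of several objects is the sum of their sizes. $\|\cdot\|_\infty$ is the maximum norm and $\mathbb{1}$ the all-ones vector. The LP considered is $\min\{c^T x \mid Ax=b,\ x\ge\ell\}$ with $A\in\mathbb{Q}^{m\times n}$ of full row rank, $m\le n$, $b\in\mathbb{Q}^m$, $c,\ell\in\mathbb{Q}^n$. Let $\mathbb{F}(p):=\{n/2^p\in\mathbb{Q} : n\in\mathbb{Z},\ |n|\le 2^{2p}\}$. A limited-precision LP oracle is an oracle for which there exist constants $p\in\mathbb{N}$, $0<\eta<1$, $\sigma>0$ such that for any LP $\min\{c^Tx : Ax=b,\ x\ge\ell\}$ with rational data, when given the LP obtained by rounding all numbers in $A,b,\ell,c$ to $\mathbb{F}(p)$, it either reports a ''failure'' or returns $\bar x\in\mathbb{F}(p)^n$, $\bar y\in\mathbb{F}(p)^m$ satisfying, with respect to the unrounded data, $\|A\bar x-b\|_\infty\le\eta$, $\bar x\ge\ell-\eta\mathbb{1}$, $c-A^T\bar y\ge-\eta\mathbb{1}$,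 and $|(\bar x-\ell)^T(c-A^T\bar y)|\le\sigma$. ''Calling the oracle for'' an LP means passing it the rounded LP. The oracle constants $p,\eta,\sigma$ and the algorithm parameter $\alpha$ are regarded as fixed. Algorithm ''Iterative Refinement for a Primal and Dual Feasible LP''. Input: rational LP data $A,b,\ell,c$ and termination tolerance $\tau\ge0$; parameter: incremental scaling limit $\alpha\in\mathbb{N}$, $\alpha\ge2$. Set $\Delta_1:=1$. Call the oracle for $\min\{c^Tx: Ax=b,\ x\ge\ell\}$; abort if it reports failure; otherwise let $(x_1,y_1)$ be the returned approximate primal-dual solution. For $k=1,2,\ldots$: (i) compute $\hat b:=b-Ax_k$, $\hat\ell:=\ell-x_k$, $\hat c:=c-A^Ty_k$; (ii) compute $\delta_k:=\max\{\max_j|\hat b_j|,\ \max_i\hat\ell_i,\ \max_i(-\hat c_i),\ |\sum_i-\hat\ell_i\hat c_i|\}$; if $\delta_k\le\tau$, return $(x_k,y_k)$; (iii) replace $\delta_k$ by $\max\{\delta_k,\,1/(\alpha\Delta_k)\}$ and set $\Delta_{k+1}:=2^{\lceil\log(1/\delta_k)\rceil}$; (iv) call the oracle for $\min\{(\Delta_{k+1}\hat c)^Tx : Ax=\Delta_{k+1}\hat b,\ x\ge\Delta_{k+1}\hat\ell\}$; abort if it reports failure; otherwise let $(\hat x,\hat y)$ be the returned approximate primal-dual solution; (v) set $(x_{k+1},y_{k+1}):=(x_k,y_k)+\frac{1}{\Delta_{k+1}}(\hat x,\hat y)$. Exact rational arithmetic is used outside the oracle.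
   Formalization: The oracle constant σ is assumed to satisfy σ < 1 instead of only σ > 0; for σ > 1 the complementarity term can keep δ_k at 1, so that Δ_k never grows and the algorithm may loop forever. *)

(* Defs.v *)
From HB Require Import structures.
From mathcomp Require Import all_boot all_order all_algebra.
From mathcomp Require Import ring lra zify.
Set Implicit Arguments.
Unset Strict Implicit.
Unset Printing Implicit Defensive.
Import Order.TTheory GRing.Theory Num.Theory.
Local Open Scope ring_scope.

(* ---------- Encoding length ---------- *)

(* [up_log 2 k] is the least e with k <= 2 ^ e, i.e. the ceiling of log k. *)
Definition int_size (z : int) : nat := (up_log 2 (`|z|%N + 1)).+1.

Definition rat_size (q : rat) : nat := (int_size (numq q) + int_size (denq q))%N.

Definition mx_size m n (A : 'M[rat]_(m, n)) : nat :=
  (\sum_i \sum_j rat_size (A i j))%N.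

Definition input_size m n (A : 'M[rat]_(m, n)) (b : 'cV[rat]_m)
    (l c : 'cV[rat]_n) (tau : rat) : nat :=
  (mx_size A + mx_size b + mx_size l + mx_size c + rat_size tau)%N.

(* ---------- Limited-precision oracles ---------- *)

(* An LP is given as (A, b, l, c); [None] is a reported failure and
   [Some (x, y)] an approximate primal-dual solution. *)
Definition lp_oracle : Type := forall m n : nat,
  'M[rat]_(m, n) -> 'cV[rat]_m -> 'cV[rat]_n -> 'cV[rat]_n ->
  option ('cV[rat]_n * 'cV[rat]_m).

Definition in_F (p : nat) (q : rat) : Prop :=
  exists z : int, `|z| <= 2 ^+ (2 * p) /\ q = z%:~R / 2 ^+ p.

(* A nearest element of F(p) (see [round_F_nearest]); ties are rounded away
   from zero, and numbers beyond the range go to the closer end point. *)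
Definition round_F (p : nat) (q : rat) : rat :=
  Num.sg q * (minn (Num.truncn (`|q| * 2 ^+ p + 2^-1)) (2 ^ (2 * p)))%:R / 2 ^+ p.

Lemma nearest_aux (u : rat) (t M : nat) (w : int) :
  t%:R <= u + 2^-1 -> u + 2^-1 < t.+1%:R -> `|w| <= M%:Z ->
  `|u - (minn t M)%:R| <= `|u - w%:~R|.
Proof.
rewrite -[t.+1%:R]natr1 => tlo thi wM.
have wle : w%:~R <= M%:R :> rat.
  by rewrite -[M%:R]/(M%:Z%:~R) ler_int (le_trans (ler_norm _)).
case: (leqP t M) => tM.
  have [[le|-> //]|lt] : (w <= t%:Z - 1 \/ w = t) \/ (w >= t%:Z + 1) by lia.
    have h : w%:~R <= t%:R - 1 :> rat by rewrite -(ler_int rat) intrB in le.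
    by rewrite [leRHS]ger0_norm ?ler_norml; [apply/andP; split|]; lra.
  have h : t%:R + 1 <= w%:~R :> rat by rewrite -(ler_int rat) intrD in lt.
  by rewrite [leRHS]ler0_norm ?ler_norml; [apply/andP; split|]; lra.
have h : M%:R + 1 <= t%:R :> rat by rewrite natr1 ler_nat.
by rewrite !ger0_norm; lra.
Qed.

Lemma round_F_nearest (p : nat) (q : rat) :
  in_F p (round_F p q) /\
  forall z, in_F p z -> `|q - round_F p q| <= `|q - z|.
Proof.
have d0 : 0 < 2 ^+ p :> rat by rewrite exprn_gt0.
set t := Num.truncn (`|q| * 2 ^+ p + 2^-1).
set M := (2 ^ (2 * p))%N.
have MZ : (2 : int) ^+ (2 * p) = M%:Z by rewrite -natrX natz.
split.
  exists (sgz q * (minn t M)%:Z); split; last first.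
    by rewrite /round_F -/t -/M intrM /= sgrEz.
  rewrite MZ normrM normr_sgz ger0_norm //; apply: le_trans (_ : (minn t M)%:Z <= _).
    by case: (_ != 0); rewrite ?mul1r ?mul0r.
  by rewrite lez_nat geq_minr.
move=> _ [z [zM ->]].
rewrite -(ler_pM2r d0) -[X in _ * X](ger0_norm (ltW d0)) -[X in _ <= _ * X](ger0_norm (ltW d0)) -!normrM.
rewrite !mulrBl /round_F -/t -/M !divfK ?gt_eqF //.
set a := q * 2 ^+ p; set s := Num.sg q.
have aE : a = s * (`|q| * 2 ^+ p) by rewrite mulrA -numEsg.
have u0 : 0 <= `|q| * 2 ^+ p by rewrite mulr_ge0 // ltW.
have /andP[tlo thi] : t%:R <= `|q| * 2 ^+ p + 2^-1 < t.+1%:R.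
  by apply: truncn_itv; rewrite addr_ge0.
set u := `|q| * 2 ^+ p in aE u0 tlo thi.
have zM' : `|z| <= M%:Z by rewrite -MZ.
have key (w : int) := @nearest_aux u t M w tlo thi.
case: (ltrgt0P q) (erefl s) => [qp|qn|q0]; rewrite {2}/s.
- by rewrite (gtr0_sg qp) => sE; rewrite aE sE !mul1r; apply: key.
- rewrite (ltr0_sg qn) => sE; have := key (- z); rewrite normrN => /(_ zM').
  rewrite aE sE intrN => H.
  have -> : -1 * u - -1 * (minn t M)%:R = - (u - (minn t M)%:R) by rewrite !mulN1r opprB opprK addrC.
  have -> : -1 * u - z%:~R = - (u - - z%:~R) by rewrite mulN1r opprK opprD.
  by rewrite !normrN.
by rewrite /s q0 sgr0 => _; rewrite mul0r /a q0 !mul0r subrr normr0.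
Qed.

Definition call (O : lp_oracle) (p : nat) m n (A : 'M[rat]_(m, n))
    (b : 'cV[rat]_m) (l c : 'cV[rat]_n) : option ('cV[rat]_n * 'cV[rat]_m) :=
  O m n (map_mx (round_F p) A) (map_mx (round_F p) b)
        (map_mx (round_F p) l) (map_mx (round_F p) c).

Definition norm_max m (v : 'cV[rat]_m) : rat := \big[Num.max/0]_i `|v i 0|.

Definition limited_precision (R : archiRealFieldType) (p : nat) (eta sigma : R)
    (O : lp_oracle) : Prop :=
  forall m n (A : 'M[rat]_(m, n)) (b : 'cV[rat]_m) (l c : 'cV[rat]_n) x y,
    call O p A b l c = Some (x, y) ->
    [/\ (forall j, in_F p (x j 0)) /\ (forall i, in_F p (y i 0)),
        ratr (norm_max (A *m x - b)) <= eta,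
        forall j, ratr (l j 0) - eta <= ratr (x j 0),
        forall j, - eta <= ratr ((c - A^T *m y) j 0)
      & ratr `|((x - l)^T *m (c - A^T *m y)) 0 0| <= sigma].

(* ---------- Iterative refinement ---------- *)

(* Ceiling of the binary logarithm of q > 0 (see [ceil_log2P]). *)
Definition ceil_log2 (q : rat) : int :=
  if 1 <= q then Posz (up_log 2 `|Num.ceil q|%N)
  else - Posz (trunc_log 2 (Num.truncn q^-1)).

Lemma ceil_log2P (q : rat) : 0 < q -> 2 ^ (ceil_log2 q - 1) < q <= 2 ^ ceil_log2 q.
Proof.
move=> q0; rewrite /ceil_log2; case: ifPn => [q1|]; last first.
  rewrite -ltNge => q1.
  have iq1 : 1 <= q^-1 by rewrite invf_ge1 // ltW.
  have k0 : (0 < Num.truncn q^-1)%N by rewrite truncn_gt0.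
  have /andP[lo hi] := trunc_log_bounds (isT : 1 < 2)%N k0.
  have iq0 : 0 <= q^-1 by rewrite invr_ge0 ltW.
  have /andP[tlo thi] := truncn_itv iq0.
  set e := trunc_log _ _ in lo hi *; apply/andP; split.
    rewrite -opprD -PoszD addn1 -exprz_inv -exprnP exprVn invf_plt ?posrE ?exprn_gt0 //.
    by rewrite -natrX (lt_le_trans thi) // ler_nat.
  rewrite -exprz_inv -exprnP exprVn -[leLHS]invrK lef_pV2 ?posrE ?invr_gt0 ?exprn_gt0 //.
  by rewrite -natrX (le_trans _ tlo) // ler_nat.
have c1 : 1 <= Num.ceil q by rewrite -gtz0_ge1 ceil_gt0 (lt_le_trans _ q1).
have cE : (Num.ceil q)%:~R = (`|Num.ceil q|%N)%:R :> rat.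
  by rewrite -[in LHS](gez0_abs (_ : 0 <= Num.ceil q)) //; apply: le_trans c1.
have /andP[clo chi] := ceil_itv q.
set k := `|Num.ceil q|%N in cE *.
rewrite -exprnP; apply/andP; split; last first.
  by rewrite (le_trans chi) // cE -natrX ler_nat up_logP.
case: (ltnP 1 k) => k1; last first.
  have -> : up_log 2 k = 0%N by case: (k) k1 => [|[|]].
  by rewrite sub0r exprN1; apply: lt_le_trans q1; lra.
have /andP[lo _] := up_log_bounds (isT : 1 < 2)%N k1.
have u0 : (0 < up_log 2 k)%N by rewrite up_log_gt0.
have -> : Posz (up_log 2 k) - 1 = Posz (up_log 2 k).-1 by lia.
rewrite -exprnP -natrX (le_lt_trans _ clo) // intrD cE intrN.
by rewrite -[_%:R in leLHS]/(_%:R) lerBrDr natr1 ler_nat.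
Qed.

(* Starting the maxima at 0 is harmless: the fourth quantity is nonnegative. *)
Definition violation m n (hb : 'cV[rat]_m) (hl hc : 'cV[rat]_n) : rat :=
  Num.max (\big[Num.max/0]_j `|hb j 0|)
  (Num.max (\big[Num.max/0]_i hl i 0)
  (Num.max (\big[Num.max/0]_i - hc i 0)
           `|\sum_i - hl i 0 * hc i 0|)).

Inductive outcome (S : Type) : Type := Returned of S | Aborted.
Arguments Aborted {S}.

(* The loop started at iterate (x, y) with scaling factor D, after [calls]
   oracle calls, and cut off after [fuel] rounds ([None]).  A result consists
   of the total number of oracle calls and the outcome.  If the oracle may
   leave a complementarity violation of 1 or more, delta can stay at 1, so that
   D never grows and the loop runs forever; bounding that violation by a
   constant below 1 excludes this. *)
Fixpoint refine_loop (O : lp_oracle) (p alpha : nat) m n (A : 'M[rat]_(m, n))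
    (b : 'cV[rat]_m) (l c : 'cV[rat]_n) (tau : rat) (fuel calls : nat)
    (x : 'cV[rat]_n) (y : 'cV[rat]_m) (D : rat) :
    option (nat * outcome ('cV[rat]_n * 'cV[rat]_m)) :=
  if fuel is fuel'.+1 then
    let hb := b - A *m x in
    let hl := l - x in
    let hc := c - A^T *m y in
    let delta := violation hb hl hc in
    if delta <= tau then Some (calls, Returned (x, y)) else
    let delta' := Num.max delta (alpha%:R * D)^-1 in
    let D' := 2 ^ ceil_log2 delta'^-1 in
    if call O p A (D' *: hb) (D' *: hl) (D' *: hc) is Some (hx, hy) then
      refine_loop O p alpha A b l c tau fuel' calls.+1
        (x + D'^-1 *: hx) (y + D'^-1 *: hy) D'
    else Some (calls.+1, Aborted)
  else None.

Definition refine (O : lp_oracle) (p alpha : nat) m n (A : 'M[rat]_(m, n))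
    (b : 'cV[rat]_m) (l c : 'cV[rat]_n) (tau : rat) (fuel : nat) :
    option (nat * outcome ('cV[rat]_n * 'cV[rat]_m)) :=
  if call O p A b l c is Some (x, y) then
    refine_loop O p alpha A b l c tau fuel 1 x y 1
  else Some (1%N, Aborted).

(* ---------- Bit operations ---------- *)

(* Computations paired with the number of bit operations they perform.  The
   rule followed below: every recursive call of a function on bit strings or
   on lists handles boundedly many bits besides the computations bound inside
   it, and is charged one [tick]. *)
Definition comp (T : Type) : Type := (nat * T)%type.
Definition ret T (x : T) : comp T := (0%N, x).
Definition tick T (u : comp T) : comp T := (u.1.+1, u.2).
Definition bind T U (u : comp T) (f : T -> comp U) : comp U :=
  ((u.1 + (f u.2).1)%N, (f u.2).2).
Notation "x <- u ;; v" := (bind u (fun x => v))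
  (at level 100, u at next level, right associativity).
Notation "' x <- u ;; v" := (bind u (fun x => v))
  (at level 100, x strict pattern, u at next level, right associativity).

(* Naturals: least significant bit first, last bit [true] (0 is [::]). *)
Definition bits := seq bool.

Definition bits_val (s : bits) : nat :=
  foldr (fun (x : bool) v => (x + v.*2)%N) 0%N s.

Fixpoint nat_bits_rec (fuel k : nat) : bits :=
  if fuel is f.+1 then
    if k == 0%N then [::] else odd k :: nat_bits_rec f k./2
  else [::].
Definition nat_bits (k : nat) : bits := nat_bits_rec k k.

Lemma bits_val_nat_bits (k : nat) : bits_val (nat_bits k) = k.
Proof.
suff H f j : (j <= f)%N -> bits_val (nat_bits_rec f j) = j by exact: H.
elim: f j => [|f IH] [|j] //= lej; rewrite IH; last by lia.
by rewrite -addnn; lia.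
Qed.

(* Prepends a low-order bit, keeping 0 represented by [::]. *)
Definition bcons (x : bool) (s : bits) : bits :=
  if ~~ x && nilp s then [::] else x :: s.

Fixpoint binc (carry : bool) (s : bits) : comp bits :=
  if ~~ carry then ret s else
  match s with
  | [::] => ret [:: true]
  | x :: s' => tick (r <- binc x s' ;; ret (~~ x :: r))
  end.

Fixpoint badd (carry : bool) (s t : bits) : comp bits :=
  match s, t with
  | [::], _ => binc carry t
  | _, [::] => binc carry s
  | x :: s', y :: t' =>
      tick (r <- badd ((x && y) || (carry && (x || y))) s' t' ;;
            ret ((x (+) y (+) carry) :: r))
  end.

Fixpoint bdec (borrow : bool) (s : bits) : comp bits :=
  if ~~ borrow then ret s else
  match s with
  | [::] => ret [::]
  | x :: s' => tick (r <- bdec (~~ x) s' ;; ret (bcons (~~ x) r))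
  end.

Fixpoint bsub (borrow : bool) (s t : bits) : comp bits :=
  match s, t with
  | [::], _ => ret [::]
  | _, [::] => bdec borrow s
  | x :: s', y :: t' =>
      tick (r <- bsub ((~~ x && (y || borrow)) || (y && borrow)) s' t' ;;
            ret (bcons (x (+) y (+) borrow) r))
  end.

(* Comparison s <= t; [acc] is the result for the lower-order bits. *)
Fixpoint bleq (acc : bool) (s t : bits) : comp bool :=
  match s, t with
  | [::], [::] => ret acc
  | [::], _ => ret true
  | _, [::] => ret false
  | x :: s', y :: t' => tick (bleq (if x == y then acc else y) s' t')
  end.

Fixpoint bmul (s t : bits) : comp bits :=
  match s with
  | [::] => ret [::]
  | x :: s' =>
      tick (r <- bmul s' t ;;
            let r := bcons false r in
            if x then badd false t r else ret r)
  end.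

Fixpoint bdivmod (s d : bits) : comp (bits * bits) :=
  match s with
  | [::] => ret ([::], [::])
  | x :: s' =>
      tick (' (q, r) <- bdivmod s' d ;;
            let r := bcons x r in
            ge <- bleq true d r ;;
            if ge then r' <- bsub false r d ;; ret (true :: q, r')
            else ret (bcons false q, r))
  end.

(* [fuel] only serves termination. *)
Fixpoint bgcd_rec (fuel : nat) (s t : bits) : comp bits :=
  if nilp t then ret s else
  if fuel is f.+1 then tick (' (_, r) <- bdivmod s t ;; bgcd_rec f t r)
  else ret s.
(* Two Euclidean steps at least halve the second argument. *)
Definition bgcd (s t : bits) : comp bits := bgcd_rec (2 * size t).+2 s t.

Fixpoint bshl (k : nat) (s : bits) : comp bits :=
  if k is k'.+1 then tick (r <- bshl k' s ;; ret (bcons false r)) else ret s.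

(* 2 ^ size s *)
Fixpoint bpow_size (s : bits) : comp bits :=
  if s is _ :: s' then tick (r <- bpow_size s' ;; ret (false :: r))
  else ret [:: true].

(* (2 ^ (size t - size s), 2 ^ (size s - size t)), truncated subtractions *)
Fixpoint bpow_diff (s t : bits) : comp (bits * bits) :=
  match s, t with
  | _ :: s', _ :: t' => tick (bpow_diff s' t')
  | [::], _ => e <- bpow_size t ;; ret (e, [:: true])
  | _, [::] => f <- bpow_size s ;; ret ([:: true], f)
  end.

(* Sign-magnitude fractions in lowest terms; 0 may carry either sign. *)
Record brat := BRat { bneg : bool; bnum : bits; bden : bits }.

Definition dec_rat (x : brat) : rat :=
  (-1) ^+ bneg x * (bits_val (bnum x))%:R / (bits_val (bden x))%:R.
Definition enc_rat (q : rat) : brat :=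
  BRat (q < 0) (nat_bits `|numq q|%N) (nat_bits `|denq q|%N).

Lemma enc_ratK : cancel enc_rat dec_rat.
Proof.
move=> q; rewrite /dec_rat /= !bits_val_nat_bits -[RHS]divq_num_den.
congr (_ / _); last by rewrite -[RHS]/(_%:~R) -[in RHS](gez0_abs (denq_ge0 q)).
by rewrite [in RHS](intEsign (numq q)) numq_lt0 intrM rmorphXn rmorphN1.
Qed.

Definition bnormalize (neg : bool) (u v : bits) : comp brat :=
  g <- bgcd u v ;;
  ' (u', _) <- bdivmod u g ;;
  ' (v', _) <- bdivmod v g ;;
  ret (BRat neg u' v').

Definition qadd (x y : brat) : comp brat :=
  u <- bmul (bnum x) (bden y) ;;
  w <- bmul (bnum y) (bden x) ;;
  v <- bmul (bden x) (bden y) ;;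
  if bneg x == bneg y then s <- badd false u w ;; bnormalize (bneg x) s v
  else
    ge <- bleq true w u ;;
    if ge then s <- bsub false u w ;; bnormalize (bneg x) s v
    else s <- bsub false w u ;; bnormalize (bneg y) s v.

Definition qopp (x : brat) : comp brat :=
  tick (ret (BRat (~~ bneg x) (bnum x) (bden x))).
Definition qabs (x : brat) : comp brat :=
  tick (ret (BRat false (bnum x) (bden x))).
Definition qinv (x : brat) : comp brat :=
  tick (ret (BRat (bneg x) (bden x) (bnum x))).
Definition qsub (x y : brat) : comp brat := y' <- qopp y ;; qadd x y'.

Definition qmul (x y : brat) : comp brat :=
  u <- bmul (bnum x) (bnum y) ;;
  v <- bmul (bden x) (bden y) ;;
  bnormalize (bneg x (+) bneg y) u v.

Definition qleq (x y : brat) : comp bool :=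
  tick (u <- bmul (bnum x) (bden y) ;;
        w <- bmul (bnum y) (bden x) ;;
        match bneg x, bneg y with
        | false, false => bleq true u w
        | true, true => bleq true w u
        | true, false => ret true
        | false, true => ret (nilp u && nilp w)
        end).

Definition qmax (x y : brat) : comp brat :=
  le <- qleq x y ;; ret (if le then y else x).

Definition qzero : brat := BRat false [::] [:: true].
Definition qone : brat := BRat false [:: true] [:: true].

(* [round_F p] *)
Definition qround (p : nat) (x : brat) : comp brat :=
  u <- bshl p.+1 (bnum x) ;;
  w <- badd false u (bden x) ;;
  v <- bshl 1 (bden x) ;;
  ' (k, _) <- bdivmod w v ;;
  top <- bshl (2 * p) [:: true] ;;
  le <- bleq true k top ;;
  d <- bshl p [:: true] ;;
  bnormalize (bneg x) (if le then k else top) d.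

(* 2 ^ ceil (log (1 / x)) for x = u / v > 0: with L := size v - size u one has
   2 ^ (L - 1) < v / u < 2 ^ (L + 1), so the exponent is L or L + 1. *)
Definition qpow2 (x : brat) : comp brat :=
  ' (e, f) <- bpow_diff (bnum x) (bden x) ;;
  vf <- bmul (bden x) f ;;
  ue <- bmul (bnum x) e ;;
  le <- bleq true vf ue ;;
  ret (if le then BRat false e f
       else if f is false :: f' then BRat false e f'
       else BRat false (false :: e) f).

(* Vectors are lists of entries, matrices lists of rows. *)
Definition bvec := seq brat.
Definition bmat := seq bvec.

Fixpoint cmap T U (f : T -> comp U) (s : seq T) : comp (seq U) :=
  if s is x :: s' then tick (y <- f x ;; r <- cmap f s' ;; ret (y :: r))
  else ret [::].

Fixpoint cmap2 T U V (f : T -> U -> comp V) (s : seq T) (t : seq U) :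
    comp (seq V) :=
  match s, t with
  | x :: s', y :: t' => tick (z <- f x y ;; r <- cmap2 f s' t' ;; ret (z :: r))
  | _, _ => ret [::]
  end.

Fixpoint cfold T U (f : T -> U -> comp U) (u : U) (s : seq T) : comp U :=
  if s is x :: s' then tick (r <- cfold f u s' ;; f x r) else ret u.

Definition bscale (a : brat) (s : bvec) : comp bvec := cmap (qmul a) s.

Definition bdot (s t : bvec) : comp brat :=
  r <- cmap2 qmul s t ;; cfold qadd qzero r.

(* b - A x *)
Definition bresidual (A : bmat) (b x : bvec) : comp bvec :=
  r <- cmap (fun row => bdot row x) A ;; cmap2 qsub b r.

(* c - A^T y, subtracting the multiples of the rows of A one by one *)
Fixpoint breduced (A : bmat) (c y : bvec) : comp bvec :=
  match A, y with
  | row :: A', t :: y' =>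
      tick (v <- breduced A' c y' ;; s <- bscale t row ;; cmap2 qsub v s)
  | _, _ => ret c
  end.

Definition bviolation (hb hl hc : bvec) : comp brat :=
  ab <- cmap qabs hb ;;
  d1 <- cfold qmax qzero ab ;;
  d2 <- cfold qmax qzero hl ;;
  nc <- cmap qopp hc ;;
  d3 <- cfold qmax qzero nc ;;
  nl <- cmap qopp hl ;;
  s <- bdot nl hc ;;
  d4 <- qabs s ;;
  d34 <- qmax d3 d4 ;;
  d234 <- qmax d2 d34 ;;
  qmax d1 d234.

Definition dec_vec n (s : bvec) : 'cV[rat]_n :=
  \col_(i < n) dec_rat (nth qzero s i).
Definition enc_vec n (v : 'cV[rat]_n) : bvec :=
  [seq enc_rat (v i 0) | i <- enum 'I_n].
Definition dec_mat m n (A : bmat) : 'M[rat]_(m, n) :=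
  \matrix_(i < m, j < n) dec_rat (nth qzero (nth [::] A i) j).
Definition enc_mat m n (A : 'M[rat]_(m, n)) : bmat :=
  [seq [seq enc_rat (A i j) | j <- enum 'I_n] | i <- enum 'I_m].

(* The oracle itself is consulted free of charge; rounding is charged. *)
Definition bcall (O : lp_oracle) (p m n : nat) (A : bmat) (b l c : bvec) :
    comp (option (bvec * bvec)) :=
  rA <- cmap (cmap (qround p)) A ;;
  rb <- cmap (qround p) b ;;
  rl <- cmap (qround p) l ;;
  rc <- cmap (qround p) c ;;
  tick (ret (omap (fun xy => (enc_vec xy.1, enc_vec xy.2))
    (O m n (dec_mat m n rA) (dec_vec m rb) (dec_vec n rl) (dec_vec n rc)))).

Fixpoint brefine_loop (O : lp_oracle) (p alpha m n : nat) (A : bmat)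
    (b l c : bvec) (tau : brat) (fuel calls : nat) (x y : bvec) (D : brat) :
    comp (option (nat * outcome (bvec * bvec))) :=
  if fuel is fuel'.+1 then
    tick (hb <- bresidual A b x ;;
          hl <- cmap2 qsub l x ;;
          hc <- breduced A c y ;;
          delta <- bviolation hb hl hc ;;
          stop <- qleq delta tau ;;
          if stop then ret (Some (calls, Returned (x, y))) else
          aD <- qmul (BRat false (nat_bits alpha) [:: true]) D ;;
          iaD <- qinv aD ;;
          delta' <- qmax delta iaD ;;
          D' <- qpow2 delta' ;;
          sb <- bscale D' hb ;;
          sl <- bscale D' hl ;;
          sc <- bscale D' hc ;;
          ans <- bcall O p m n A sb sl sc ;;
          if ans is Some (hx, hy) then
            iD <- qinv D' ;;
            dx <- bscale iD hx ;;
            x' <- cmap2 qadd x dx ;;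
            dy <- bscale iD hy ;;
            y' <- cmap2 qadd y dy ;;
            brefine_loop O p alpha m n A b l c tau fuel' calls.+1 x' y' D'
          else ret (Some (calls.+1, Aborted)))
  else ret None.

Definition brefine (O : lp_oracle) (p alpha m n : nat) (A : bmat)
    (b l c : bvec) (tau : brat) (fuel : nat) :
    comp (option (nat * outcome (bvec * bvec))) :=
  ans <- bcall O p m n A b l c ;;
  if ans is Some (x, y) then
    brefine_loop O p alpha m n A b l c tau fuel 1 x y qone
  else ret (Some (1%N, Aborted)).

Definition dec_outcome m n (r : outcome (bvec * bvec)) :
    outcome ('cV[rat]_n * 'cV[rat]_m) :=
  if r is Returned (x, y) then Returned (dec_vec n x, dec_vec m y) else Aborted.

(* Main.v *)
Require Import Defs.
From mathcomp Require Import all_boot all_order all_algebra.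
From mathcomp Require Import ring lra zify.
Set Implicit Arguments.
Unset Strict Implicit.
Unset Printing Implicit Defensive.
Import Order.TTheory GRing.Theory Num.Theory.
Local Open Scope ring_scope.

(** Why iterative refinement runs in oracle-polynomial time.

    Oracle calls.  The scaling factors are powers of two, D = 2 ^ e.  A problem
    whose residuals were multiplied by D is solved by the oracle with feasibility
    errors at most eta < 1 and complementarity error at most sigma < 1.  After
    division by D these become errors below 1 / D and below 1 / D ^ 2, so the
    violation delta of the new iterate is below 1 / D ([violation_after_call]).
    The quantity max (delta, 1 / (alpha D)) then lies in [1 / (alpha D), 1 / D),
    and the next factor, the least power of two that is at least its inverse, has
    an exponent e' with e < e' <= e + alpha ([exponent_step]): passing to the next
    power of two turns a gain that could be tiny, when eta or sigma is close to
    1, into at least one doubling.  Hence k <= e <= alpha k after k rounds.  A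
    round that does not stop has tau < 2 ^ - e, and since tau is at least the
    inverse of its denominator, e is below the size of tau
    ([exponent_lt_rat_size]).  So there are at most N + 1 calls for an input of
    size N, and all exponents are at most alpha (N + 1).

    Bit operations.  [israt S q x] says that the fraction x has value q and that
    its numerator and its denominator are shorter than S.  These bounds add up
    under both addition and multiplication of fractions, whether or not the result
    can be reduced, so a residual computed from numbers of length S has length
    O(N S).  Applying this to the iterates from one round to the next would
    multiply the length by N each time and give an exponential bound.  Two facts
    break this recursion.  The new factor D is a power of two, whose length is
    governed by its exponent and not by the fraction delta from which it was
    computed ([qpow2_spec]).  And an iterate is its predecessor plus an oracle
    answer, which has constant length because it lies in F(p), divided by D; so a
    round adds only O(N) to the length of the iterate.  All operands of all rounds
    are therefore of polynomial length, each operation on them costs polynomially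
    many bit operations, and [brefine_loop_spec] adds up these costs while it
    checks that the bit level program follows the exact one. *)

(** * Computations with a bound on their cost *)

Local Open Scope nat_scope.

(** A Hoare triple for costed computations.  The bound is an upper bound, so
    costs can be rounded up to common expressions at every step. *)
Definition runs T (B : nat) (P : T -> Prop) (u : Defs.comp T) : Prop :=
  (u.1 <= B)%N /\ P u.2.

Lemma runs_ret T B (P : T -> Prop) x : P x -> runs B P (ret x).
Proof. by []. Qed.

Lemma runs_tick T B (P : T -> Prop) u : runs B P u -> runs B.+1 P (tick u).
Proof. by case. Qed.

Lemma runs_bind T U B1 B2 (P : T -> Prop) (Q : U -> Prop) u f :
  runs B1 P u -> (forall x, P x -> runs B2 Q (f x)) ->
  runs (B1 + B2) Q (bind u f).
Proof. by move=> [c1 Pu] /(_ _ Pu)[c2 Qf]; split=> //=; apply: leq_add. Qed.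

Lemma runs_le T B B' (P : T -> Prop) u :
  runs B P u -> (B <= B')%N -> runs B' P u.
Proof. by case=> c Pu leB; split=> //; apply: leq_trans leB. Qed.

Lemma runs_sub T B (P Q : T -> Prop) u :
  runs B P u -> (forall x, P x -> Q x) -> runs B Q u.
Proof. by case=> c Pu PQ; split=> //; apply: PQ. Qed.

(** * Arithmetic on bit strings *)

(** The last bit is the most significant one.  Canonical strings are what ties
    lengths to values: bounding the length of a result reduces to bounding its
    value ([size_le_exp]). *)
Definition canon (s : bits) : bool := last true s.

Lemma canon_behead x s : canon (x :: s) -> canon s.
Proof. by case: s. Qed.

Lemma canon_bcons x s : canon s -> canon (bcons x s).
Proof. by case: x; case: s. Qed.

Lemma bits_val_bcons (x : bool) s : bits_val (bcons x s) = (x + (bits_val s).*2).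
Proof. by case: x; case: s. Qed.

Lemma bits_val_lt s : bits_val s < 2 ^ size s.
Proof. by elim: s => //= x s IH; rewrite expnS; case: x; lia. Qed.

Lemma exp_le_bits_val s : canon s -> s != [::] -> 2 ^ (size s).-1 <= bits_val s.
Proof.
elim: s => //= x [|y s] IH cs _; first by case: x cs.
by move: (IH cs isT); rewrite /= expnS; lia.
Qed.

Lemma size_le_exp s k : canon s -> bits_val s < 2 ^ k -> size s <= k.
Proof.
case: s => [//|x s] cs lt.
by have := leq_ltn_trans (exp_le_bits_val cs isT) lt; rewrite ltn_exp2l.
Qed.

Lemma bits_val_eq0 s : canon s -> (bits_val s == 0) = nilp s.
Proof.
move=> cs; case: s cs => [//|x s] cs; apply/negbTE; rewrite -lt0n.
by apply: leq_trans (exp_le_bits_val cs isT); rewrite expn_gt0.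
Qed.

Lemma canon_cons x s : canon s -> x || (s != [::]) -> canon (x :: s).
Proof. by case: x; case: s. Qed.

Lemma canon_nat_bits k : canon (nat_bits k).
Proof.
suff H f j : j <= f -> canon (nat_bits_rec f j) by apply: H.
elim: f j => [//|f IH] [//|j] ltj; apply: canon_cons; first by apply: IH; lia.
by case: j ltj => [|j] //; case: f {IH} => // f _; rewrite /= orbT.
Qed.

Definition bits_spec (v : nat) (r : bits) : Prop := canon r /\ bits_val r = v.

Lemma binc_spec (carry : bool) s : canon s ->
  runs (size s) (bits_spec (carry + bits_val s)) (binc carry s).
Proof.
elim: s carry => [|x s IH] [] //= cs; apply: runs_tick.
rewrite -[size s]addn0; apply: runs_bind (IH x (canon_behead cs)) _ => r [cr vr].
apply: runs_ret; split; last by rewrite /= vr; case: (x) => /=; lia.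
by apply: canon_cons cr _; case: r vr; case: (x) => //=; lia.
Qed.

Lemma badd_spec (carry : bool) s t : canon s -> canon t ->
  runs (size s + size t) (bits_spec (carry + bits_val s + bits_val t))
       (badd carry s t).
Proof.
elim: s carry t => [|x s IH] carry t cs ct.
  by rewrite addn0; apply: binc_spec.
case: t ct => [|y t] ct; first by rewrite /= !addn0; apply: (@binc_spec carry (x :: s)).
apply: (@runs_le _ (size s + size t + 0).+1); last by rewrite /=; lia.
apply: runs_tick; apply: runs_bind (IH _ t (canon_behead cs) (canon_behead ct)) _.
move=> r [cr vr]; apply: runs_ret; split.
  apply: (canon_cons cr); case: r vr {cr} => [/= e|? ? _]; last exact: orbT.
  have [] : bits_val s = 0 /\ bits_val t = 0 by lia.
  move=> /eqP; rewrite (bits_val_eq0 (canon_behead cs)) => /nilP es.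
  move=> /eqP; rewrite (bits_val_eq0 (canon_behead ct)) => /nilP et.
  move: cs ct e; rewrite {}es {}et.
  by case: (x); case: (y); case: (carry).
by rewrite /= vr; case: (x); case: (y); case: (carry) => /=; lia.
Qed.

Lemma bdec_spec (borrow : bool) s : canon s -> borrow <= bits_val s ->
  runs (size s) (bits_spec (bits_val s - borrow)) (bdec borrow s).
Proof.
elim: s borrow => [|x s IH] [] // cs le; try by apply: runs_ret; split=> //; lia.
rewrite /= -[size s]addn0; apply: runs_tick.
have le' : ~~ x <= bits_val s by move: le; case: (x) => /=; lia.
apply: runs_bind (IH (~~ x) (canon_behead cs) le') _ => r [cr vr].
apply: runs_ret; split; first exact: canon_bcons.
by rewrite bits_val_bcons vr; move: le le'; case: (x) => /=; lia.
Qed.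

Lemma bsub_spec (borrow : bool) s t : canon s -> bits_val t + borrow <= bits_val s ->
  runs (size s) (bits_spec (bits_val s - bits_val t - borrow)) (bsub borrow s t).
Proof.
elim: s borrow t => [|x s IH] borrow t cs le; first by apply: runs_ret.
case: t le => [|y t] le; first by rewrite subn0; apply: bdec_spec.
rewrite [bsub _ _ _]/= [size _]/= -[size s]addn0; apply: runs_tick.
set b' := _ || _; have le' : bits_val t + b' <= bits_val s.
  by move: le; rewrite {}/b'; case: (x); case: (y); case: (borrow) => /=; lia.
apply: runs_bind (IH b' t (canon_behead cs) le') _ => r [cr vr].
apply: runs_ret; split; first exact: canon_bcons.
rewrite bits_val_bcons vr; move: le le'; rewrite /b'.
by case: (x); case: (y); case: (borrow) => /=; lia.
Qed.

(** Reading the low-order bits first, the accumulator tells whether a tie on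
    the remaining bits counts as success; [~~ acc] makes the test strict. *)
Lemma bleq_spec (acc : bool) s t : canon s -> canon t ->
  runs (size s) (fun r => r = (bits_val s + ~~ acc <= bits_val t)) (bleq acc s t).
Proof.
elim: s acc t => [|x s IH] acc [|y t] cs ct.
- by apply: runs_ret; case: acc.
- apply: runs_ret; apply/esym.
  have : bits_val (y :: t) != 0 by rewrite bits_val_eq0.
  by case: acc; rewrite /= -?lt0n; lia.
- apply: runs_ret; apply/esym/negbTE.
  have : bits_val (x :: s) != 0 by rewrite bits_val_eq0.
  by rewrite /= -?lt0n; lia.
apply/runs_tick/(runs_sub (IH _ _ (canon_behead cs) (canon_behead ct))) => r ->.
by case: (x); case: (y); case: (acc) => /=; lia.
Qed.

(** Every bit of s costs at most one addition of numbers of length at most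
    size s + size t and size t. *)
Lemma bmul_spec s t : canon s -> canon t ->
  runs (size s * (size s + 2 * size t).+1) (bits_spec (bits_val s * bits_val t))
       (bmul s t).
Proof.
move=> + ct; elim: s => [|x s IH] cs; first exact: runs_ret.
set Z := (size s + 2 * size t).+1.
apply: (@runs_le _ (size s * Z + Z + 0).+1); last by rewrite /= /Z; nia.
apply: runs_tick; rewrite addn0; apply: runs_bind (IH (canon_behead cs)) _.
move=> r [cr vr]; have cr' := canon_bcons false cr.
have vr' : bits_val (bcons false r) = (bits_val s * bits_val t).*2.
  by rewrite bits_val_bcons vr.
have szr : size (bcons false r) <= (size s + size t).+1.
  apply: size_le_exp cr' _; rewrite vr' expnS expnD mul2n ltn_double.
  by apply: ltn_mul; apply: bits_val_lt.
case: (x) => /=; last first.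
  by apply: runs_ret; split=> //; rewrite vr' add0n doubleMl.
apply: (runs_le (runs_sub (badd_spec false ct cr') _)); last by rewrite /Z; lia.
by move=> q [cq vq]; split; rewrite ?vq ?vr' // mulnDl mul1n doubleMl.
Qed.

Lemma size_mod_le s d r : canon d -> canon r -> d != [::] ->
  bits_val r = bits_val s %% bits_val d -> size r <= size d.
Proof.
move=> cd cr d0 vr; apply: size_le_exp cr _; rewrite vr.
apply: ltn_trans (bits_val_lt d); rewrite ltn_mod lt0n bits_val_eq0 //.
by case: d d0 {cd vr}.
Qed.

Definition cost_divmod S := S * (2 * S + 2).

(** Schoolbook division: the running remainder stays below d, so after a new
    bit is appended it is below 2 d and one conditional subtraction restores the
    invariant.  Remainders are never longer than d, which bounds the cost. *)
Lemma bdivmod_spec s d : canon d -> d != [::] ->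
  runs (size s * (2 * size d + 2))
       (fun qr => bits_spec (bits_val s %/ bits_val d) qr.1 /\
                  bits_spec (bits_val s %% bits_val d) qr.2)
       (bdivmod s d).
Proof.
move=> cd d0; have vd : 0 < bits_val d.
  by rewrite lt0n bits_val_eq0 //; case: (d) d0.
elim: s => [|x s IH]; first by apply: runs_ret; rewrite div0n mod0n.
apply: (@runs_le _ (size s * (2 * size d + 2) + (2 * size d + 1)).+1).
  apply: runs_tick; apply: runs_bind IH _ => -[q r] [] /= [cq vq] [cr vr].
  have cr' := canon_bcons x cr.
  have szr : size (bcons x r) <= (size d).+1.
    have := size_mod_le cd cr d0 vr; have : size (bcons x r) <= (size r).+1.
      by rewrite /bcons; case: ifP.
    by lia.
  have vr' := bits_val_bcons x r.
  have rlt : bits_val r < bits_val d by rewrite vr ltn_mod.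
  have sE := divn_eq (bits_val s) (bits_val d); rewrite -vq -vr in sE.
  (* Quotient and remainder are unique, so any decomposition of the new
     value with a small remainder gives both. *)
  have uniq q' r' : r' < bits_val d ->
      x + (bits_val s).*2 = q' * bits_val d + r' ->
      (x + (bits_val s).*2) %/ bits_val d = q' /\
      (x + (bits_val s).*2) %% bits_val d = r'.
    by move=> lt ->; rewrite divnMDl // modnMDl divn_small // modn_small // addn0.
  apply: (@runs_le _ (size d + (size d + 1))); last by lia.
  apply: runs_bind (bleq_spec true cd cr') _ => ge ->; rewrite addn0.
  case: leqP => le.
    apply: (@runs_le _ (size (bcons x r) + 0)); last by lia.
    have hs : bits_val d + false <= bits_val (bcons x r) by rewrite addn0.
    apply: runs_bind (bsub_spec cr' hs) _ => r2 [cr2 vr2]; apply: runs_ret => /=.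
    have [] := @uniq (2 * bits_val q + 1) (bits_val r2); try by nia.
    by rewrite /bits_spec => -> ->; do !split=> //=; lia.
  apply: runs_ret => /=.
  have [] := @uniq (2 * bits_val q) (bits_val (bcons x r)); try by nia.
  rewrite /bits_spec => -> ->; do !split=> //=; first exact: canon_bcons.
  by rewrite bits_val_bcons; lia.
by rewrite /=; nia.
Qed.

(** Two Euclidean steps replace t by t mod (s mod t), which is less than t / 2
    and hence at least one bit shorter, so fuel 2 * size t is enough. *)
Lemma bgcd_rec_val f s t : canon s -> canon t -> 2 * size t <= f ->
  bits_val (bgcd_rec f s t).2 = gcdn (bits_val s) (bits_val t).
Proof.
move=> cs ct; suff H k : size t <= k -> 2 * k <= f ->
    bits_val (bgcd_rec f s t).2 = gcdn (bits_val s) (bits_val t) by apply: H.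
elim: k f s t cs ct => [|k IH] f s t cs ct szt lef.
  by case: t ct szt => // _ _; case: f {lef} => [|f] /=; rewrite gcdn0.
have [/nilP -> | t0] := boolP (nilp t).
  by case: f {lef} => [|f] /=; rewrite gcdn0.
case: f lef => [|[|f]] lef; try lia.
have t0' : t != [::] by case: (t) t0.
rewrite [bgcd_rec _ _ _]/= (negbTE t0) /=.
case: (bdivmod s t) (bdivmod_spec s ct t0') => c [q r] [_ [_ [/= cr vr]]].
rewrite -gcdn_modl gcdnC -vr.
have [/nilP -> | r0] := boolP (nilp r); first by rewrite /= gcdn0.
have r0' : r != [::] by case: (r) r0.
rewrite /=; case: (bdivmod t r) (bdivmod_spec t cr r0') => c' [q' r'].
move=> [_ [_ [/= cr' vr']]]; rewrite IH //; last by lia.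
  by rewrite vr' gcdn_modr gcdnC.
apply: size_le_exp cr' _; rewrite vr'.
have rgt0 : 0 < bits_val r by rewrite lt0n bits_val_eq0.
have tgt0 : 0 < bits_val t by rewrite lt0n bits_val_eq0.
have rt : bits_val r < bits_val t by rewrite vr ltn_mod.
have m1 : bits_val t %% bits_val r < bits_val r by rewrite ltn_mod.
have m2 := divn_eq (bits_val t) (bits_val r).
have d1 : 0 < bits_val t %/ bits_val r by rewrite divn_gt0 // ltnW.
have tlt : bits_val t < 2 * 2 ^ k.
  by rewrite -expnS; apply: leq_trans (bits_val_lt t) _; rewrite leq_exp2l.
by nia.
Qed.

Lemma bgcd_rec_cost S f s t : canon s -> canon t -> size s <= S -> size t <= S ->
  runs (f * (cost_divmod S).+1) (fun g => canon g) (bgcd_rec f s t).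
Proof.
elim: f s t => [|f IH] s t cs ct sS tS; rewrite [bgcd_rec _ _ _]/=; case: ifPn => t0 //.
rewrite mulSn addSn; apply: runs_tick.
have t0' : t != [::] by case: (t) t0.
have H := runs_le (bdivmod_spec s ct t0')
  (leq_mul sS (leq_add (leq_mul (leqnn 2) tS) (leqnn 2))).
apply: runs_bind H _ => -[q r] [] _ [] /= cr vr; apply: IH => //.
by apply: leq_trans (size_mod_le ct cr t0' vr) _.
Qed.

Definition cost_norm S := (2 * S + 2) * (cost_divmod S).+1 + 2 * cost_divmod S.

Ltac size_lia :=
  repeat match goal with
  | H : ?P |- _ =>
      lazymatch P with
      | context [bits_val] => clear H
      | is_true (leq _ _) => fail
      | @eq nat _ _ => fail
      | _ => clear H
      end
  end; lia.

Definition cost_mul Z := Z * (2 * Z).+1.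

Lemma bmul_spec_size S T s t : canon s -> canon t -> size s < S -> size t < T ->
  runs (cost_mul (S + T))
    (fun r => bits_spec (bits_val s * bits_val t) r /\ (size r).+1 < S + T)
    (bmul s t).
Proof.
move=> cs ct sS tT; apply: (@runs_sub _ _ (bits_spec (bits_val s * bits_val t))).
  by apply: runs_le (bmul_spec cs ct) _; apply: leq_mul; lia.
move=> r [cr vr]; split=> //.
suff : size r <= size s + size t by lia.
by apply: size_le_exp cr _; rewrite vr expnD ltn_mul ?bits_val_lt.
Qed.

Lemma bits_val_neq0 s : canon s -> 0 < bits_val s -> s != [::].
Proof. by case: s. Qed.

Lemma bshl_spec k s : canon s ->
  runs k (bits_spec (2 ^ k * bits_val s)) (bshl k s).
Proof.
move=> cs; elim: k => [|k IH]; first by apply: runs_ret; rewrite expn0 mul1n.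
apply: runs_tick; rewrite -[X in runs X]addn0; apply: runs_bind IH _ => r [cr vr].
by apply: runs_ret; split; [exact: canon_bcons | rewrite bits_val_bcons vr expnS; lia].
Qed.

Definition bpow2 k : bits := nseq k false ++ [:: true].

Lemma bits_val_bpow2 k : bits_val (bpow2 k) = 2 ^ k.
Proof. by elim: k => // k IH; rewrite /= -/(bpow2 k) IH expnS; lia. Qed.

Lemma canon_bpow2 k : canon (bpow2 k).
Proof. by elim: k => // k IH; apply: canon_cons IH _; case: k. Qed.

Lemma size_bpow2 k : size (bpow2 k) = k.+1.
Proof. by rewrite size_cat size_nseq addn1. Qed.

Lemma bpow_size_spec s : runs (size s) (fun r => r = bpow2 (size s)) (bpow_size s).
Proof.
elim: s => //= _ s IH; apply: runs_tick; rewrite -[X in runs X]addn0.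
by apply: runs_bind IH _ => r ->.
Qed.

Lemma bpow_diff_spec s t :
  runs (size s + size t)
    (fun ef => ef = (bpow2 (size t - size s), bpow2 (size s - size t)))
    (bpow_diff s t).
Proof.
elim: s t => [|x s IH] [|y t] //.
- rewrite [bpow_diff _ _]/= subn0 -[0 + _]addn0.
  by apply: runs_bind (bpow_size_spec (y :: t)) _ => r ->.
- rewrite [bpow_diff _ _]/= subn0.
  by apply: runs_bind (bpow_size_spec (x :: s)) _ => r ->.
by apply: (@runs_le _ (size s + size t).+1); [exact: runs_tick | rewrite /=; lia].
Qed.

(** How the lengths a and b of u and v determine e, the ceiling of log (v / u).
    The quotient v / u lies strictly between 2 ^ (b - a - 1) and
    2 ^ (b - a + 1), so one comparison decides between the exponents b - a and
    b - a + 1.  As e is natural here, a > b is only possible for e = 0. *)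
Lemma pow2_exponent u v a b e :
  0 < a -> 0 < b -> 2 ^ a.-1 <= u < 2 ^ a -> 2 ^ b.-1 <= v < 2 ^ b ->
  v <= 2 ^ e * u -> 2 ^ e * u < 2 * v ->
  if v * 2 ^ (a - b) <= u * 2 ^ (b - a) then a - b = 0 /\ b - a = e
  else a - b = 0 /\ (b - a).+1 = e \/ [/\ a - b = 1, b - a = 0 & e = 0].
Proof.
move=> a0 b0 /andP[ulo uhi] /andP[vlo vhi] hv1 hv2.
have u0 : 0 < u by apply: leq_trans ulo; rewrite expn_gt0.
have v0 : 0 < v by apply: leq_trans vlo; rewrite expn_gt0.
have uniq k : v <= 2 ^ k * u -> 2 ^ k * u < 2 * v -> k = e.
  (* The two bounds on v determine the exponent. *)
  have lt_exp i j : v <= 2 ^ i * u -> 2 ^ j * u < 2 * v -> j <= i.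
    move=> hi hj; rewrite -ltnS -(ltn_exp2l _ _ (isT : 1 < 2)) -(ltn_pmul2r u0).
    by apply: leq_trans hj _; rewrite expnS -mulnA leq_mul2l.
  by move=> h1 h2; apply/eqP; rewrite eqn_leq; apply/andP; split; apply: lt_exp.
have [ab|ba] := leqP a b.
  have -> : a - b = 0 by apply/eqP.
  have bE : 2 ^ b = 2 ^ (b - a) * 2 ^ a by rewrite -expnD subnK.
  have bE2 : 2 ^ b = 2 * 2 ^ b.-1 by rewrite -expnS prednK.
  have aE2 : 2 ^ a = 2 * 2 ^ a.-1 by rewrite -expnS prednK.
  rewrite expn0 muln1; case: leqP => le.
    split=> //; apply: uniq; first by rewrite mulnC.
    apply: (@leq_trans (2 ^ (b - a) * 2 ^ a)); first by rewrite ltn_pmul2l ?expn_gt0.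
    by rewrite -bE bE2 leq_mul2l.
  left; split=> //; apply: uniq; rewrite expnS.
    apply: ltnW; apply: leq_trans vhi _; rewrite bE aE2.
    by rewrite mulnCA mulnA leq_mul2l ulo orbT.
  by rewrite -mulnA ltn_pmul2l // mulnC.
have -> : b - a = 0 by apply/eqP; rewrite subn_eq0 ltnW.
have abS : a - b = (a - b).-1.+1 by rewrite prednK // subn_gt0.
have aE : 2 ^ a.-1 = 2 ^ (a - b).-1 * 2 ^ b.
  by rewrite -expnD; congr (2 ^ _); lia.
have key : 2 ^ (a - b).-1 * v < u.
  by apply: leq_trans ulo; rewrite aE ltn_pmul2l // expn_gt0.
have ult : u < 2 * v by apply: leq_ltn_trans hv2; rewrite leq_pmull ?expn_gt0.
have ab1 : (a - b).-1 = 0.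
  case: (a - b).-1 key => // k lt; have := leq_ltn_trans (ltnW lt) ult.
  by rewrite ltn_pmul2r // expnS -[X in _ < X]muln1 ltn_pmul2l // ltnNge expn_gt0.
move: key; rewrite abS ab1 expn0 muln1 mul1n expn1 [v * 2]mulnC [2 * v <= u]leqNgt ult /= => key.
by right; split=> //; apply/esym/uniq; rewrite mul1n // ltnW.
Qed.

(** * Arithmetic on fractions *)

(** One bound for all operations on two fractions with [israt S] and
    [israt T], where Z = S + T. *)
Definition cost_rat Z := 3 * cost_mul Z + 2 * Z + cost_norm Z + 2.

Lemma cost_rat_le Z Z' : Z <= Z' -> cost_rat Z <= cost_rat Z'.
Proof.
move=> le; rewrite /cost_rat /cost_mul /cost_norm /cost_divmod.
by do !(apply: leq_add || apply: leq_mul || rewrite ltnS) => //;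
   rewrite ltnS; do !(apply: leq_add || apply: leq_mul) => //.
Qed.

(** Every intermediate number of the rounding is shorter than S + 2 p + 3. *)
Definition cost_round p S :=
  7 * (S + 2 * p + 3) + cost_divmod (S + 2 * p + 3) + cost_norm (S + 2 * p + 3).

Local Open Scope ring_scope.

(** The number S exceeds both lengths by at least one.  This slack absorbs the
    carry of an addition, so that [israt S] and [israt T] give [israt (S + T)] for
    sums as well as for products. *)
Definition israt (S : nat) (q : rat) (x : brat) : Prop :=
  [/\ [&& canon (bnum x), canon (bden x) & bden x != [::]],
      (size (bnum x) < S)%N, (size (bden x) < S)%N & dec_rat x = q].

Lemma israt_le S T q x : israt S q x -> (S <= T)%N -> israt T q x.
Proof.
by case=> c n d e le; split=> //; [apply: leq_trans n le|apply: leq_trans d le].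
Qed.

(** Division by the gcd cannot lengthen anything, so the lengths of the
    unreduced fraction bound those of the reduced one. *)
Lemma bnormalize_spec S (neg : bool) u v : canon u -> canon v -> v != [::] ->
  (size u < S)%N -> (size v < S)%N ->
  runs (cost_norm S)
    (israt S ((-1) ^+ neg * (bits_val u)%:R / (bits_val v)%:R))
    (bnormalize neg u v).
Proof.
move=> cu cv v0 uS vS.
apply: (@runs_le _ ((2 * S + 2) * (cost_divmod S).+1 +
                    (cost_divmod S + (cost_divmod S + 0)))); last first.
  by rewrite /cost_norm; lia.
have vgt0 : (0 < bits_val v)%N by rewrite lt0n bits_val_eq0 //; case: (v) v0.
have Hg : runs ((2 * S + 2) * (cost_divmod S).+1)
    (bits_spec (gcdn (bits_val u) (bits_val v))) (bgcd u v).
  have [c cg] := bgcd_rec_cost (2 * size v).+2 cu cv (ltnW uS) (ltnW vS).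
  split; last by split=> //; rewrite bgcd_rec_val //; lia.
  by apply: leq_trans c _; apply: leq_mul => //; lia.
apply: runs_bind Hg _ => g [cg vg].
have ggt0 : (0 < bits_val g)%N by rewrite vg gcdn_gt0 vgt0 orbT.
have g0 : g != [::] by apply/eqP => g0; move: ggt0; rewrite g0.
have gS : (size g <= S)%N.
  apply: leq_trans (ltnW vS); apply: size_le_exp cg _.
  by apply: leq_ltn_trans (bits_val_lt v); rewrite vg dvdn_leq // dvdn_gcdr.
have cost (w : bits) : (size w < S)%N -> (size w * (2 * size g + 2) <= cost_divmod S)%N.
  by move=> wS; apply: leq_mul; [apply: ltnW | rewrite leq_add2r leq_mul2l].
apply: runs_bind (runs_le (bdivmod_spec u cg g0) (cost u uS)) _.
move=> -[u' ?] [] /= [cu' vu'] _.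
apply: runs_bind (runs_le (bdivmod_spec v cg g0) (cost v vS)) _.
move=> -[v' ?] [] /= [cv' vv'] _; apply: runs_ret.
have uE : (bits_val u = bits_val u' * bits_val g)%N.
  by rewrite vu' divnK // vg dvdn_gcdl.
have vE : (bits_val v = bits_val v' * bits_val g)%N.
  by rewrite vv' divnK // vg dvdn_gcdr.
have v'gt0 : (0 < bits_val v')%N by move: vgt0; rewrite vE; case: (bits_val v').
split=> /=.
- by rewrite cu' cv'; apply/eqP => e; rewrite e in v'gt0.
- apply: leq_ltn_trans uS; apply: size_le_exp cu' _.
  by apply: leq_ltn_trans (bits_val_lt u); rewrite vu' leq_div.
- apply: leq_ltn_trans vS; apply: size_le_exp cv' _.
  by apply: leq_ltn_trans (bits_val_lt v); rewrite vv' leq_div.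
rewrite /dec_rat /= uE vE !natrM -!mulrA; congr (_ * _).
have gn0 : (bits_val g)%:R != 0 :> rat by rewrite pnatr_eq0 -lt0n.
have vn0 : (bits_val v')%:R != 0 :> rat by rewrite pnatr_eq0 -lt0n.
by field; rewrite gn0.
Qed.

(** The numerators over the common denominator are shorter than S + T - 1, and
    adding them produces at most one more bit. *)
Lemma qadd_spec_tight S T q r x y : israt S q x -> israt T r y ->
  runs (3 * cost_mul (S + T) + 2 * (S + T) + cost_norm (S + T))
    (israt (S + T) (q + r)) (qadd x y).
Proof.
move=> [/and3P[cnx cdx dx0] nx dx <-] [/and3P[cny cdy dy0] ny dy <-].
set Z := (S + T)%N.
have TS : (T + S = Z)%N by rewrite addnC.
have dxv : (bits_val (bden x))%:R != 0 :> rat.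
  by rewrite pnatr_eq0 bits_val_eq0 //; case: (bden x) dx0.
have dyv : (bits_val (bden y))%:R != 0 :> rat.
  by rewrite pnatr_eq0 bits_val_eq0 //; case: (bden y) dy0.
apply: (@runs_le _ (cost_mul Z + (cost_mul Z + (cost_mul Z + (2 * Z + cost_norm Z))))).
  rewrite /qadd; apply: runs_bind (bmul_spec_size cnx cdy nx dy) _ => u [[cu vu] su].
  have := bmul_spec_size cny cdx ny dx; rewrite TS => Hw.
  apply: runs_bind Hw _ => w [[cw vw] sw].
  apply: runs_bind (bmul_spec_size cdx cdy dx dy) _ => v [[cv vv] sv].
  have v0 : v != [::].
    apply/eqP => e; move: vv dxv dyv; rewrite e /= => /esym/eqP.
    by rewrite muln_eq0 !pnatr_eq0 => /orP[] ->.
  have vE : (bits_val v)%:R = (bits_val (bden x))%:R * (bits_val (bden y))%:R :> rat.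
    by rewrite vv natrM.
  have sizes s : canon s -> (bits_val s <= bits_val u + bits_val w)%N ->
      (size s < Z)%N.
    move=> cs le; suff : (size s <= Z.-1)%N by size_lia.
    apply: size_le_exp cs _; apply: leq_ltn_trans le _.
    have -> : (Z.-1 = Z.-2.+1)%N by size_lia.
    rewrite expnS mul2n -addnn -addSn; apply: leq_add.
      by apply: leq_trans (bits_val_lt u) _; rewrite leq_exp2l //; size_lia.
    by apply: ltnW (leq_trans (bits_val_lt w) _); rewrite leq_exp2l //; size_lia.
  have uE : (bits_val u)%:R = (bits_val (bnum x))%:R * (bits_val (bden y))%:R :> rat.
    by rewrite vu natrM.
  have wE : (bits_val w)%:R = (bits_val (bnum y))%:R * (bits_val (bden x))%:R :> rat.
    by rewrite vw natrM.
  have final neg s e : canon s -> (bits_val s <= bits_val u + bits_val w)%N ->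
      (-1) ^+ nat_of_bool neg * (bits_val s)%:R = e :> rat ->
      e / (bits_val v)%:R = dec_rat x + dec_rat y ->
      runs (cost_norm Z) (israt Z (dec_rat x + dec_rat y)) (bnormalize neg s v).
    move=> cs le <- <-; apply: bnormalize_spec => //; first exact: sizes.
    by size_lia.
  case: ifP => [/eqP sg|sg].
    have Hs := runs_le (badd_spec false cu cw) (_ : (_ <= 2 * Z)%N).
    apply: runs_bind (Hs _) _ => [|s [cs vs]]; first by size_lia.
    apply: final cs _ (erefl _) _; first by rewrite vs.
    rewrite vs add0n natrD uE wE vE /dec_rat sg.
    by field; rewrite ?dxv ?dyv.
  rewrite mul2n -addnn -addnA.
  have Hle := runs_le (bleq_spec true cw cu) (_ : (_ <= Z)%N).
  apply: runs_bind (Hle _) _ => [|ge ->]; first by size_lia.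
  rewrite addn0; case: leqP => [le|/ltnW le].
    have Hs := runs_le (@bsub_spec false u w cu _) (_ : (_ <= Z)%N).
    apply: runs_bind (Hs _ _) _ => [||s [cs vs]]; rewrite ?addn0 //; first by size_lia.
    apply: final cs _ (erefl _) _.
      by rewrite vs subn0; apply: leq_trans (leq_subr _ _) _; rewrite ?leq_addl ?leq_addr.
    rewrite vs subn0 natrB // uE wE vE /dec_rat.
    have -> : bneg y = ~~ bneg x by case: (bneg x) (bneg y) sg => [] [].
    by rewrite signrN; field; rewrite ?dxv ?dyv.
  have Hs := runs_le (@bsub_spec false w u cw _) (_ : (_ <= Z)%N).
  apply: runs_bind (Hs _ _) _ => [||s [cs vs]]; rewrite ?addn0 //; first by size_lia.
  apply: final cs _ (erefl _) _.
    by rewrite vs subn0; apply: leq_trans (leq_subr _ _) _; rewrite ?leq_addl ?leq_addr.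
  rewrite vs subn0 natrB // uE wE vE /dec_rat.
  have -> : bneg x = ~~ bneg y by case: (bneg x) (bneg y) sg => [] [].
  by rewrite signrN; field; rewrite ?dxv ?dyv.
by rewrite /=; size_lia.
Qed.

Lemma qadd_spec S T q r x y : israt S q x -> israt T r y ->
  runs (cost_rat (S + T)) (israt (S + T) (q + r)) (qadd x y).
Proof.
by move=> hx hy; apply: runs_le (qadd_spec_tight hx hy) _; rewrite /cost_rat; size_lia.
Qed.

Lemma qopp_spec S q x : israt S q x ->
  runs 1 (israt S (- q)) (qopp x).
Proof.
move=> [wx nx dx <-]; apply/runs_tick/runs_ret; split=> //=.
by rewrite /dec_rat /= signrN !mulNr.
Qed.

Lemma israt_abs S q x : israt S q x ->
  israt S `|q| (BRat false (bnum x) (bden x)).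
Proof.
move=> [wx nx dx <-]; split=> //.
by rewrite /dec_rat /= normrM normrM normr_sign normfV !ger0_norm ?ler0n.
Qed.

Lemma qabs_spec S q x : israt S q x ->
  runs 1 (israt S `|q|) (qabs x).
Proof. by move=> hx; apply/runs_tick/runs_ret; apply: israt_abs. Qed.

Lemma qsub_spec S T q r x y : israt S q x -> israt T r y ->
  runs (cost_rat (S + T)) (israt (S + T) (q - r)) (qsub x y).
Proof.
move=> hx hy; rewrite /cost_rat addn2 -add1n.
apply: runs_bind (qopp_spec hy) _ => y' hy'.
by apply: runs_le (qadd_spec_tight hx hy') _.
Qed.

Lemma israt_den S q x : israt S q x -> (bits_val (bden x))%:R != 0 :> rat.
Proof.
move=> [/and3P[_ cd d0] _ _ _].
by rewrite pnatr_eq0 bits_val_eq0 //; case: (bden x) d0.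
Qed.

Lemma israt_num S q x : israt S q x -> (bnum x == [::]) = (q == 0).
Proof.
move=> hx; have dn0 := israt_den hx; case: hx => [/and3P[cn _ _] _ _ <-].
rewrite /dec_rat !mulf_eq0 signr_eq0 invr_eq0 (negbTE dn0) orbF /=.
by rewrite pnatr_eq0 bits_val_eq0 //; case: (bnum x).
Qed.

Lemma qinv_spec S q x : q != 0 -> israt S q x ->
  runs 1 (israt S q^-1) (qinv x).
Proof.
move=> q0 hx; have := israt_num hx; rewrite (negbTE q0) => n0.
have dn0 := israt_den hx; case: hx => [/and3P[cn cd _] n d <-].
apply/runs_tick/runs_ret; split=> //=; first by rewrite cn cd n0.
by rewrite /dec_rat /= !invfM invrK invr_sign; ring.
Qed.

Lemma qmul_spec S T q r x y : israt S q x -> israt T r y ->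
  runs (cost_rat (S + T)) (israt (S + T) (q * r)) (qmul x y).
Proof.
move=> hx hy; have dxn := israt_den hx; have dyn := israt_den hy.
case: hx hy => [/and3P[cnx cdx dx0] nx dx <-] [/and3P[cny cdy dy0] ny dy <-].
set Z := (S + T)%N.
apply: (@runs_le _ (cost_mul Z + (cost_mul Z + cost_norm Z))).
  apply: runs_bind (bmul_spec_size cnx cny nx ny) _ => u [[cu vu] su].
  apply: runs_bind (bmul_spec_size cdx cdy dx dy) _ => v [[cv vv] sv].
  have v0 : v != [::].
    apply/eqP => e; move: vv dxn dyn; rewrite e /= => /esym/eqP.
    by rewrite muln_eq0 !pnatr_eq0 => /orP[] ->.
  have -> : dec_rat x * dec_rat y =
      (-1) ^+ nat_of_bool (bneg x (+) bneg y) * (bits_val u)%:R / (bits_val v)%:R.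
    by rewrite vu vv !natrM /dec_rat signr_addb; field; rewrite ?dxn ?dyn.
  by apply: bnormalize_spec => //; size_lia.
by rewrite /cost_rat; size_lia.
Qed.

Lemma qleq_spec S T q r x y : israt S q x -> israt T r y ->
  runs (cost_rat (S + T)) (fun le => le = (q <= r)) (qleq x y).
Proof.
move=> hx hy; have dxn := israt_den hx; have dyn := israt_den hy.
have [hx0 hy0] := (israt_num hx, israt_num hy).
case: hx hy hx0 hy0 => [/and3P[cnx cdx dx0] nx dx <-].
move=> [/and3P[cny cdy dy0] ny dy <-] hx0 hy0.
set Z := (S + T)%N; have TS : (T + S = Z)%N by rewrite addnC.
apply: (@runs_le _ (cost_mul Z + (cost_mul Z + Z)).+1); last by rewrite /cost_rat; size_lia.
apply: runs_tick.
apply: runs_bind (bmul_spec_size cnx cdy nx dy) _ => u [[cu vu] su].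
have := bmul_spec_size cny cdx ny dx; rewrite TS => Hw.
apply: runs_bind Hw _ => w [[cw vw] sw].
have dxp : 0 < (bits_val (bden x))%:R :> rat by rewrite lt0r dxn ler0n.
have dyp : 0 < (bits_val (bden y))%:R :> rat by rewrite lt0r dyn ler0n.
have nd (z : brat) : 0 <= (bits_val (bnum z))%:R / (bits_val (bden z))%:R :> rat.
  by rewrite divr_ge0 ?ler0n.
have leE : ((bits_val (bnum x))%:R / (bits_val (bden x))%:R <=
            (bits_val (bnum y))%:R / (bits_val (bden y))%:R :> rat) =
           (bits_val u <= bits_val w)%N.
  by rewrite ler_pdivrMr // mulrAC ler_pdivlMr // -!natrM ler_nat vu vw.
have geE : ((bits_val (bnum y))%:R / (bits_val (bden y))%:R <=
            (bits_val (bnum x))%:R / (bits_val (bden x))%:R :> rat) =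
           (bits_val w <= bits_val u)%N.
  by rewrite ler_pdivrMr // mulrAC ler_pdivlMr // -!natrM ler_nat vu vw.
have u0 : nilp u = (dec_rat x == 0).
  rewrite -hx0 -bits_val_eq0 // vu muln_eq0 !bits_val_eq0 //.
  by case: (bnum x) (bden y) dy0 => [|??] [].
have w0 : nilp w = (dec_rat y == 0).
  rewrite -hy0 -bits_val_eq0 // vw muln_eq0 !bits_val_eq0 //.
  by case: (bnum y) (bden x) dx0 => [|??] [].
rewrite u0 w0 /dec_rat; case: (bneg x); case: (bneg y); rewrite -!mulrA ?expr1 ?expr0 ?mul1r.
- rewrite !mulN1r lerN2 geE.
  by apply: runs_le (runs_sub (bleq_spec true cw cu) _) _ => [r' ->|]; rewrite ?addn0; size_lia.
- apply: runs_ret; apply/esym; rewrite mulN1r; apply: le_trans (nd y).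
  by rewrite oppr_le0 nd.
- apply: runs_ret; rewrite mulN1r oppr_eq0; apply/andP/idP => [[/eqP-> /eqP->]|le].
    by rewrite oppr0.
  have := nd x; have := nd y; split; apply/eqP; lra.
rewrite leE.
by apply: runs_le (runs_sub (bleq_spec true cu cw) _) _ => [r' ->|]; rewrite ?addn0; size_lia.
Qed.

Lemma qmax_spec S q r x y : israt S q x -> israt S r y ->
  runs (cost_rat (S + S)) (israt S (Num.max q r)) (qmax x y).
Proof.
move=> hx hy; rewrite -[cost_rat _]addn0.
apply: runs_bind (qleq_spec hx hy) _ => le ->; apply: runs_ret.
by case: leP.
Qed.

Lemma israt_bpow2 e : israt (e + 2) (2 ^+ e) (BRat false (bpow2 e) (bpow2 0)).
Proof.
split; rewrite /= ?canon_bpow2 ?size_bpow2 //; try by lia.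
by rewrite /dec_rat /= bits_val_bpow2 expr0 mul1r divr1 natrX.
Qed.

(** The length of the result depends on the exponent e alone and not on the
    length of the operand; this keeps the scaling factors short. *)
Lemma qpow2_spec S q x (e : nat) : israt S q x -> 0 < q ->
  ceil_log2 q^-1 = e ->
  runs (cost_rat (S + S)) (israt (e + 2) (2 ^+ e)) (qpow2 x).
Proof.
move=> hx q0 ce; have dn0 := israt_den hx.
have num0 : bnum x != [::] by rewrite (israt_num hx) gt_eqF.
case: hx => [/and3P[cn cd dx0] n d qE]; set Z := (S + S)%N.
have u0 : (0 < bits_val (bnum x))%N.
  by rewrite lt0n bits_val_eq0 //; case: (bnum x) num0.
have v0 : (0 < bits_val (bden x))%N.
  by rewrite lt0n bits_val_eq0 //; case: (bden x) dx0.
set u := bits_val (bnum x) in u0 *; set v := bits_val (bden x) in v0 dn0 *.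
have un0 : u%:R != 0 :> rat by rewrite pnatr_eq0 -lt0n.
have up : 0 < u%:R :> rat by rewrite ltr0n.
have qiE : q^-1 = v%:R / u%:R.
  have : 0 < dec_rat x by rewrite qE.
  rewrite -qE /dec_rat -/u -/v; case: (bneg x); last by rewrite mul1r invf_div.
  rewrite expr1 -mulrA mulN1r oppr_gt0 => lt0.
  by have := le_lt_trans (divr_ge0 (ler0n _ u) (ler0n _ v)) lt0; rewrite ltxx.
have [hv1 hv2] : (v <= 2 ^ e * u)%N /\ (2 ^ e * u < 2 * v)%N.
  have := ceil_log2P (_ : 0 < q^-1); rewrite invr_gt0 q0 ce => /(_ isT) /andP[].
  rewrite qiE ler_pdivrMr // ltr_pdivlMr // -exprnP.
  rewrite expfzDr // -exprnP exprN1 -natrX -natrM ler_nat => lt ->; split=> //.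
  by rewrite -(ltr_nat rat) !natrM; lra.
have sa : (0 < size (bnum x))%N by case: (bnum x) num0.
have sb : (0 < size (bden x))%N by case: (bden x) dx0.
have := pow2_exponent sa sb _ _ hv1 hv2.
rewrite /u /v !exp_le_bits_val // !bits_val_lt -/u -/v => /(_ isT isT).
move=> expE; clear hv1 hv2 sa sb.
apply: (@runs_le _ (2 * Z + (cost_mul Z + (cost_mul Z + Z)))); last first.
  by have : (Z <= cost_mul Z)%N := leq_pmulr _ (ltn0Sn _); rewrite /cost_rat; lia.
set da := (size (bden x) - size (bnum x))%N in expE *.
set db := (size (bnum x) - size (bden x))%N in expE *.
have H1 := runs_le (bpow_diff_spec (bnum x) (bden x)) (_ : _ <= 2 * Z)%N.
apply: runs_bind (H1 _) _ => [|_ ->]; first by rewrite /Z; lia.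
rewrite -/da -/db.
have costE (s : bits) k : (size s < S)%N -> (k < S)%N ->
    (size s * (size s + 2 * size (bpow2 k)).+1 <= cost_mul Z)%N.
  by move=> sS kS; apply: leq_mul; rewrite /Z ?size_bpow2; lia.
have Hm s k : canon s -> (size s < S)%N -> (k < S)%N ->
  runs (cost_mul Z) (fun r => bits_spec (bits_val s * 2 ^ k) r /\ (size r <= Z)%N)
    (bmul s (bpow2 k)).
  move=> cs sS kS; have H := runs_le (bmul_spec cs (canon_bpow2 k)) (costE s k sS kS).
  apply: runs_sub H _ => r; rewrite bits_val_bpow2 => -[cr vr]; split=> //.
  apply: (@leq_trans (size s + k)); last by rewrite leq_add // ltnW.
  apply: size_le_exp cr _; rewrite vr expnD ltn_pmul2r ?expn_gt0 //.
  exact: bits_val_lt.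
apply: runs_bind (Hm _ db cd d _) _ => [|vf [[cvf vvf] svf]]; first by rewrite /db; lia.
apply: runs_bind (Hm _ da cn n _) _ => [|ue [[cue vue] sue]]; first by rewrite /da; lia.
rewrite -[Z]addn0; apply: runs_bind (runs_le (bleq_spec true cvf cue) svf) _ => _ ->.
rewrite addn0 vvf vue -/u -/v; apply: runs_ret; move: expE.
case: ifP => _ [].
- by move=> -> <-; exact: israt_bpow2.
- by case=> -> <-; exact: (israt_bpow2 da.+1).
by case=> -> -> ->; exact: (israt_bpow2 0).
Qed.

Lemma truncn_divn (w v : nat) : (0 < v)%N ->
  Num.truncn (w%:R / v%:R : rat) = (w %/ v)%N.
Proof.
move=> v0; apply: truncn_def; have v0' : 0 < v%:R :> rat by rewrite ltr0n.
rewrite ler_pdivlMr // ltr_pdivrMr // -!natrM ler_nat ltr_nat.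
by rewrite leq_trunc_div -ltn_divLR // ltnS leqnn.
Qed.

(** With |q| = n / d, the rounded multiple of 2 ^ - p is the floor of
    |q| 2 ^ p + 1 / 2, that is (2 ^ (p + 1) n + d) / (2 d) in integer division. *)
Lemma qround_spec p S q x : israt S q x ->
  runs (cost_round p S) (fun z => dec_rat z = round_F p q) (qround p x).
Proof.
move=> hx; have dn0 := israt_den hx; have hx0 := israt_num hx.
case: hx hx0 => [/and3P[cn cd dx0] n d <-] hx0.
have v0 : (0 < bits_val (bden x))%N by rewrite lt0n -(pnatr_eq0 rat).
set Z := (S + 2 * p + 3)%N.
apply: (@runs_le _ (Z + (Z + Z + (Z + (cost_divmod Z + (Z + (Z + (Z + cost_norm Z))))))));
  last by rewrite /cost_round -/Z; lia.
have H1 := runs_le (bshl_spec p.+1 cn) (_ : _ <= Z)%N.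
apply: runs_bind (H1 _) _ => [|u [cu vu]]; first by rewrite /Z; size_lia.
have su : (size u <= S + p)%N.
  apply: size_le_exp cu _; rewrite vu.
  apply: (@leq_trans (2 ^ p.+1 * 2 ^ size (bnum x))).
    by rewrite ltn_pmul2l ?expn_gt0 // bits_val_lt.
  by rewrite -expnD leq_exp2l //; size_lia.
have H2 := runs_le (badd_spec false cu cd) (_ : _ <= Z + Z)%N.
apply: runs_bind (H2 _) _ => [|w [cw vw]]; first by rewrite /Z; size_lia.
have sw : (size w <= S + p.+1)%N.
  apply: size_le_exp cw _; rewrite vw add0n addnS expnS mul2n -addnn -addSn.
  apply: leq_add.
    by apply: leq_trans (bits_val_lt u) _; rewrite leq_exp2l.
  apply: ltnW; apply: leq_trans (bits_val_lt _) _; rewrite leq_exp2l //.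
  by size_lia.
have H3 := runs_le (bshl_spec 1 cd) (_ : _ <= Z)%N.
apply: runs_bind (H3 _) _ => [|v [cv vv]]; first by rewrite /Z; size_lia.
have vgt0 : (0 < bits_val v)%N by rewrite vv muln_gt0 expn_gt0.
have vne : v != [::] by apply: bits_val_neq0.
have sv : (size v <= S)%N.
  apply: size_le_exp cv _; rewrite vv expn1.
  apply: (@leq_trans (2 * 2 ^ size (bden x))).
    by rewrite ltn_pmul2l // bits_val_lt.
  by rewrite -expnS leq_exp2l.
have H4 := runs_le (bdivmod_spec w cv vne) (_ : _ <= cost_divmod Z)%N.
apply: runs_bind (H4 _) _ => [|[k r] []].
  by rewrite /cost_divmod; apply: leq_mul; rewrite /Z; size_lia.
rewrite [(k, r).1]/= [(k, r).2]/= => -[ck vk] _.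
have sk : (size k <= Z)%N.
  apply: (@leq_trans (S + p.+1)); last by rewrite /Z; size_lia.
  apply: size_le_exp ck _; rewrite vk; apply: leq_ltn_trans (leq_div _ _) _.
  by apply: leq_trans (bits_val_lt w) _; rewrite leq_exp2l.
have H5 := runs_le (bshl_spec (2 * p) (isT : canon [:: true])) (_ : _ <= Z)%N.
apply: runs_bind (H5 _) _ => [|top [ct vt]]; first by rewrite /Z; size_lia.
rewrite [bits_val [:: _]]/= muln1 in vt.
have H6 := runs_le (bleq_spec true ck ct) sk.
apply: runs_bind H6 _ => le ->; rewrite addn0.
have H7 := runs_le (bshl_spec p (isT : canon [:: true])) (_ : _ <= Z)%N.
apply: runs_bind (H7 _) _ => [|e [ce ve]]; first by rewrite /Z; size_lia.
rewrite [bits_val [:: _]]/= muln1 in ve.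
have ene : e != [::] by apply: bits_val_neq0 => //; rewrite ve expn_gt0.
have se : (size e < Z)%N.
  apply: (@leq_ltn_trans p.+1); last by rewrite /Z; size_lia.
  by apply: size_le_exp ce _; rewrite ve ltn_exp2l.
set m := if _ then k else top.
have cm : canon m by rewrite /m; case: ifP.
have mE : bits_val m = minn (bits_val k) (2 ^ (2 * p)).
  by rewrite /m vt; case: leqP.
have sm : (size m < Z)%N.
  apply: (@leq_ltn_trans (2 * p).+1); last by rewrite /Z; size_lia.
  by apply: size_le_exp cm _; rewrite mE (leq_ltn_trans (geq_minr _ _)) ?ltn_exp2l.
apply: runs_sub (bnormalize_spec (bneg x) cm ce ene sm se) _ => z [_ _ _ ->].
rewrite mE ve natrX /round_F; congr (_ / _).
have absE : `|dec_rat x| = (bits_val (bnum x))%:R / (bits_val (bden x))%:R.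
  by rewrite /dec_rat !normrM normr_sign normfV !ger0_norm ?ler0n // mul1r.
have <- : bits_val k = Num.truncn (`|dec_rat x| * 2 ^+ p + 2^-1).
  rewrite vk -truncn_divn // absE vv vw vu add0n; congr Num.truncn.
  by rewrite natrD !natrM !natrX expr1 exprS; field.
have [x0|x0] := eqVneq (dec_rat x) 0; last first.
  congr (_ * _); rewrite /dec_rat !sgrM [Num.sg _^-1]gtr0_sg ?invr_gt0 ?ltr0n //.
  rewrite mulr1 [Num.sg _%:R]gtr0_sg ?mulr1.
    by case: (bneg x); rewrite ?expr0 ?expr1 ?sgrN1 ?sgr1.
  rewrite ltr0n lt0n bits_val_eq0 //; move: hx0; rewrite (negbTE x0).
  by case: (bnum x).
rewrite x0 sgr0 mul0r; move/eqP: x0; rewrite -hx0 => /eqP nx0.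
rewrite vk vw vu nx0 muln0 !add0n vv divn_small ?min0n ?mulr0 //.
by rewrite expn1 mul2n -addnn -ltn_subLR // subnn.
Qed.

Lemma size_nat_bits_le k e : (k < 2 ^ e)%N -> (size (nat_bits k) <= e)%N.
Proof.
by move=> lt; apply: size_le_exp (canon_nat_bits k) _; rewrite bits_val_nat_bits.
Qed.

Lemma size_nat_bits_int z : (size (nat_bits `|z|%N) < int_size z)%N.
Proof.
by apply: size_nat_bits_le; rewrite -addn1; apply: (@up_logP 2).
Qed.

Lemma israt_enc S q : (size (nat_bits `|numq q|%N) < S)%N ->
  (size (nat_bits `|denq q|%N) < S)%N -> israt S q (enc_rat q).
Proof.
move=> n d; split=> //=; last exact: enc_ratK.
rewrite !canon_nat_bits bits_val_neq0 ?canon_nat_bits // bits_val_nat_bits.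
by rewrite lt0n absz_eq0 denq_neq0.
Qed.

Lemma israt_enc_size q : israt (rat_size q) q (enc_rat q).
Proof.
have := size_nat_bits_int (numq q); have := size_nat_bits_int (denq q).
by move=> d n; apply: israt_enc; rewrite /rat_size; lia.
Qed.

(** Oracle answers have constant length: the reduced denominator divides
    2 ^ p, and then the numerator is at most 2 ^ p times 2 ^ p. *)
Lemma israt_enc_F p q : in_F p q -> israt (2 * p + 2) q (enc_rat q).
Proof.
move=> [z [zle qE]].
have e : numq q * 2 ^+ p = z * denq q.
  apply: (@intr_inj rat); rewrite !intrM rmorphXn /=.
  have q' : q * (denq q)%:~R = (numq q)%:~R by rewrite numqE.
  rewrite -q' {1}qE -[2%:~R]/(2%:R).
  by field; rewrite expf_neq0.
have {}e : (`|numq q| * 2 ^ p = `|z| * `|denq q|)%N.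
  by rewrite -abszM -e abszM abszX.
have dd : (`|denq q| %| 2 ^ p)%N.
  have cop := coprime_num_den q; rewrite coprime_sym in cop.
  by rewrite -(Gauss_dvdr _ cop) e dvdn_mull.
have d0 : (0 < `|denq q|)%N by rewrite absz_gt0 denq_neq0.
have dle : (`|denq q| <= 2 ^ p)%N by rewrite dvdn_leq // expn_gt0.
have zle' : (`|z| <= 2 ^ (2 * p))%N by rewrite -lez_nat abszE -[(2 ^ _)%N%:Z]natz natrX.
have nle : (`|numq q| <= 2 ^ (2 * p))%N.
  rewrite -(@leq_pmul2r (2 ^ p)) ?expn_gt0 // e.
  by apply: leq_mul.
apply: israt_enc; rewrite addn2 ltnS; apply: size_nat_bits_le.
  by apply: leq_ltn_trans nle _; rewrite ltn_exp2l.
by apply: leq_ltn_trans dle _; rewrite ltn_exp2l //; lia.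
Qed.

(** * Vectors and matrices *)

Local Open Scope nat_scope.

Lemma runs_cmap T U n (dx : T) (dy : U) B (P : 'I_n -> U -> Prop) f s :
  size s = n -> (forall i : 'I_n, runs B (P i) (f (nth dx s i))) ->
  runs (n * B.+1)
    (fun r => size r = n /\ forall i : 'I_n, P i (nth dy r i)) (cmap f s).
Proof.
elim: n s P => [|n IH] [|x s] P //=; first by move=> _ _; split=> //; split=> // -[].
move=> [sn] H; rewrite mulSn addSn; apply: runs_tick.
apply: runs_bind (H ord0) _ => y Py; rewrite -[n * _]addn0.
apply: runs_bind (IH s (fun i => P (lift ord0 i)) sn _) _ => [i|r [sr Pr]].
  exact: (H (lift ord0 i)).
apply: runs_ret; split; first by rewrite /= sr.
by move=> i; case: (unliftP ord0 i) => [j ->|-> //]; apply: Pr.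
Qed.

Lemma runs_cmap2 T U V n (dx : T) (dy : U) (dz : V) B (P : 'I_n -> V -> Prop) f s t :
  size s = n -> size t = n ->
  (forall i : 'I_n, runs B (P i) (f (nth dx s i) (nth dy t i))) ->
  runs (n * B.+1)
    (fun r => size r = n /\ forall i : 'I_n, P i (nth dz r i)) (cmap2 f s t).
Proof.
elim: n s t P => [|n IH] [|x s] [|y t] P //=.
  by move=> _ _ _; split=> //; split=> // -[].
move=> [sn] [tn] H; rewrite mulSn addSn; apply: runs_tick.
apply: runs_bind (H ord0) _ => z Pz; rewrite -[n * _]addn0.
apply: runs_bind (IH s t (fun i => P (lift ord0 i)) sn tn _) _ => [i|r [sr Pr]].
  exact: (H (lift ord0 i)).
apply: runs_ret; split; first by rewrite /= sr.
by move=> i; case: (unliftP ord0 i) => [j ->|-> //]; apply: Pr.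
Qed.

Definition cost_vec M Z := M * (cost_rat Z).+1.

Lemma cost_vec_le n M Z Z' : n <= M -> Z <= Z' -> n * (cost_rat Z).+1 <= cost_vec M Z'.
Proof. by move=> nM ZZ; apply: leq_mul => //; rewrite ltnS cost_rat_le. Qed.

Local Open Scope ring_scope.

(** Entries share one bound S; over at most N entries such uniform bounds lose
    only a factor N. *)
Definition rvec n S (v : 'I_n -> rat) (s : bvec) : Prop :=
  size s = n /\ forall i : 'I_n, israt S (v i) (nth qzero s i).

Lemma rvec_le n S T v s : @rvec n S v s -> (S <= T)%N -> rvec T v s.
Proof. by case=> sn H le; split=> // i; apply: israt_le (H i) le. Qed.

Lemma rvec_ext n S v w s : @rvec n S v s -> v =1 w -> rvec S w s.
Proof. by case=> sn H vw; split=> // i; rewrite -vw. Qed.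

Lemma rvec_behead n S v x s : @rvec n.+1 S v (x :: s) ->
  israt S (v ord0) x /\ rvec S (fun i => v (lift ord0 i)) s.
Proof.
case=> [[sn] H]; split; first exact: (H ord0).
by split=> // i; apply: (H (lift ord0 i)).
Qed.

Lemma israt_zero : israt 2 0 qzero.
Proof. by split; rewrite // /dec_rat /= mulr0 mul0r. Qed.

Lemma cfold_qadd n S M Z v s : @rvec n S v s -> (n <= M)%N -> (2 + M * S <= Z)%N ->
  runs (n * (cost_rat Z).+1) (israt (2 + n * S) (\sum_i v i)) (cfold qadd qzero s).
Proof.
move=> + + ZM; elim: n v s => [|n IH] v [|x s]; try by case.
  by move=> _ _; apply: runs_ret; rewrite big_ord0; exact: israt_zero.
move=> /rvec_behead[hx hs] nM; rewrite big_ord_recl mulSn addSn; apply: runs_tick.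
rewrite addnC; apply: runs_bind (IH _ _ hs (ltnW nM)) _ => r hr.
rewrite mulSn addnCA; apply: runs_le (qadd_spec hx hr) _; apply: cost_rat_le.
by apply: leq_trans ZM; rewrite addnCA -mulSn leq_add2l leq_mul2r nM orbT.
Qed.

Lemma cfold_qmax n S v s : @rvec n S v s -> (2 <= S)%N ->
  runs (n * (cost_rat (S + S)).+1) (israt S (\big[Num.max/0]_i v i))
    (cfold qmax qzero s).
Proof.
move=> + S2; elim: n v s => [|n IH] v [|x s]; try by case.
  by move=> _; apply: runs_ret; rewrite big_ord0; apply: israt_le israt_zero S2.
move=> /rvec_behead[hx hs]; rewrite big_ord_recl mulSn addSn; apply: runs_tick.
by rewrite addnC; apply: runs_bind (IH _ _ hs) _ => r hr; apply: qmax_spec.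
Qed.

Lemma rvec_cmap T (dx : T) n B S v f s :
  size s = n -> (forall i : 'I_n, runs B (israt S (v i)) (f (nth dx s i))) ->
  runs (n * B.+1) (rvec S v) (cmap f s).
Proof. exact: (@runs_cmap _ _ _ dx qzero _ (fun i => israt S (v i))). Qed.

Lemma rvec_cmap2 n B S v f s t : size s = n -> size t = n ->
  (forall i : 'I_n, runs B (israt S (v i)) (f (nth qzero s i) (nth qzero t i))) ->
  runs (n * B.+1) (rvec S v) (cmap2 f s t).
Proof. exact: (@runs_cmap2 _ _ _ _ qzero qzero qzero _ (fun i => israt S (v i))). Qed.

Lemma bscale_spec n S T a q v s : israt S q a -> @rvec n T v s ->
  runs (n * (cost_rat (S + T)).+1) (rvec (S + T) (fun i => q * v i)) (bscale a s).
Proof.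
move=> ha [sn hs].
by apply: (rvec_cmap (dx := qzero)) sn _ => i; apply: qmul_spec ha (hs i).
Qed.

Lemma cmap2_qadd n S T v w s t : @rvec n S v s -> @rvec n T w t ->
  runs (n * (cost_rat (S + T)).+1) (rvec (S + T) (fun i => v i + w i)) (cmap2 qadd s t).
Proof.
move=> [sn hs] [tn ht].
by apply: rvec_cmap2 sn tn _ => i; apply: qadd_spec.
Qed.

Lemma cmap2_qsub n S T v w s t : @rvec n S v s -> @rvec n T w t ->
  runs (n * (cost_rat (S + T)).+1) (rvec (S + T) (fun i => v i - w i)) (cmap2 qsub s t).
Proof.
move=> [sn hs] [tn ht].
by apply: rvec_cmap2 sn tn _ => i; apply: qsub_spec.
Qed.

Lemma cmap_qopp n S Z v s : @rvec n S v s ->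
  runs (n * (cost_rat Z).+1) (rvec S (fun i => - v i)) (cmap qopp s).
Proof.
move=> [sn hs]; apply: (rvec_cmap (dx := qzero)) sn _ => i.
by apply: runs_le (qopp_spec (hs i)) _; rewrite /cost_rat addn2.
Qed.

Lemma cmap_qabs n S Z v s : @rvec n S v s ->
  runs (n * (cost_rat Z).+1) (rvec S (fun i => `|v i|)) (cmap qabs s).
Proof.
move=> [sn hs]; apply: (rvec_cmap (dx := qzero)) sn _ => i.
by apply: runs_le (qabs_spec (hs i)) _; rewrite /cost_rat addn2.
Qed.

Lemma bdot_spec n S T M Z v w s t : @rvec n S v s -> @rvec n T w t -> (n <= M)%N ->
  (2 + (S + T) + M * (S + T) <= Z)%N ->
  runs (2 * cost_vec M Z) (israt (2 + M * (S + T)) (\sum_i v i * w i)) (bdot s t).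
Proof.
move=> [sn hs] [tn ht] nM ZM.
rewrite mul2n -addnn /bdot.
have H : runs (cost_vec M Z) (rvec (S + T) (fun i => v i * w i)) (cmap2 qmul s t).
  apply: (@runs_le _ (n * (cost_rat (S + T)).+1)); last by apply: cost_vec_le => //; lia.
  by apply: rvec_cmap2 sn tn _ => i; apply: qmul_spec.
apply: runs_bind H _ => r hr.
apply: (@runs_le _ (n * (cost_rat Z).+1)); last exact: cost_vec_le.
apply: runs_sub (cfold_qadd hr nM _) _ => [|z hz]; first by lia.
by apply: israt_le hz _; rewrite leq_add2l leq_mul2r nM orbT.
Qed.

Definition rmat m n S (A : 'M[rat]_(m, n)) (s : bmat) : Prop :=
  size s = m /\ forall i : 'I_m, rvec S (A i) (nth [::] s i).

Notation rcol S x := (rvec S (fun i => x i (0 : 'I_1))).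

Lemma bresidual_spec m n S T M Z (A : 'M_(m, n)) (b : 'cV_m) (x : 'cV_n) sA sb sx :
  rmat S A sA -> rcol S b sb -> rcol T x sx -> (m <= M)%N -> (n <= M)%N ->
  (2 + S + T + S + M * (S + T) <= Z)%N ->
  runs (M * (2 * cost_vec M Z).+1 + cost_vec M Z)
    (rcol (S + (2 + M * (S + T))) (b - A *m x)) (bresidual sA sb sx).
Proof.
move=> [sizeA hA] hb hx mM nM ZM.
have H : runs (M * (2 * cost_vec M Z).+1)
    (rcol (2 + M * (S + T)) (A *m x)) (cmap (fun row => bdot row sx) sA).
  apply: (@runs_le _ (m * (2 * cost_vec M Z).+1)); last by rewrite leq_mul2r mM orbT.
  apply: (rvec_cmap (dx := [::])) sizeA _ => i; rewrite mxE.
  by apply: bdot_spec (hA i) hx nM _; lia.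
apply: runs_bind H _ => r hr.
apply: (@runs_le _ (m * (cost_rat (S + (2 + M * (S + T)))).+1)); last first.
  by apply: cost_vec_le => //; lia.
by apply: runs_sub (cmap2_qsub hb hr) _ => z hz; apply: rvec_ext hz _ => i; rewrite !mxE.
Qed.

(** Each row of A subtracts one multiple of length S + T, so the bounds add up
    over the rows. *)
Lemma breduced_spec m n S T M Z (A : 'I_m -> 'I_n -> rat) (c : 'I_n -> rat)
    (y : 'I_m -> rat) sA sc sy :
  size sA = m -> (forall i : 'I_m, rvec S (A i) (nth [::] sA i)) ->
  rvec S c sc -> rvec T y sy -> (m <= M)%N -> (n <= M)%N ->
  (S + T + S + M * (S + T) <= Z)%N ->
  runs (m * (2 * cost_vec M Z).+1)
    (rvec (S + m * (S + T)) (fun j => c j - \sum_i A i j * y i)) (breduced sA sc sy).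
Proof.
move=> + + hc + + nM ZM; elim: m A y sA sy => [|m IH] A y [|row sA] [|t sy] //;
    try by [move=> _ _ [] | move=> ? ? []].
  move=> _ _ _ _; apply: runs_ret; rewrite addn0.
  by apply: rvec_ext hc _ => j; rewrite big_ord0 subr0.
move=> [sizeA] hA /rvec_behead[ht hy] mM.
rewrite mulSn addSn; apply: runs_tick.
have hA' i : rvec S (A (lift ord0 i)) (nth [::] sA i) by apply: (hA (lift ord0 i)).
rewrite addnC; apply: runs_bind (IH _ _ _ _ sizeA hA' hy (ltnW mM)) _ => v hv.
rewrite mul2n -addnn.
have H := runs_le (bscale_spec ht (hA ord0)) (_ : _ <= cost_vec M Z)%N.
apply: runs_bind (H _) _ => [|s hs]; first by apply: cost_vec_le => //; lia.
apply: (@runs_le _ (n * (cost_rat (S + m * (S + T) + (T + S))).+1)); last first.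
  apply: cost_vec_le => //; apply: leq_trans ZM.
  have : (m.+1 * (S + T) <= M * (S + T))%N by rewrite leq_mul2r mM orbT.
  by rewrite mulSn; lia.
apply: runs_sub (cmap2_qsub hv hs) _ => r hr.
have -> : (S + m.+1 * (S + T) = S + m * (S + T) + (T + S))%N by rewrite mulSn; lia.
apply: rvec_ext hr _ => j; rewrite big_ord_recl opprD addrA addrAC.
by congr (_ - _); rewrite mulrC.
Qed.

Lemma bviolation_spec m n H M Z (hb : 'cV_m) (hl hc : 'cV_n) sb sl sc :
  rcol H hb sb -> rcol H hl sl -> rcol H hc sc -> (m <= M)%N -> (n <= M)%N ->
  (2 <= H)%N -> (2 * (2 + H + M * (H + H)) <= Z)%N ->
  runs (8 * cost_vec M Z + 4 * cost_rat Z)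
    (israt (2 + H + M * (H + H)) (violation hb hl hc)) (bviolation sb sl sc).
Proof.
move=> rb rl rc mM nM H2; set V := (2 + H + M * (H + H))%N => ZV.
have HV : (H <= V)%N by rewrite /V; lia.
have HZ : (H + H <= Z)%N by lia.
pose cv := cost_vec M Z; pose cr := cost_rat Z.
apply: (@runs_le _ (cv + (cv + (cv + (cv + (cv + (cv + (2 * cv +
  (cr + (cr + (cr + cr))))))))))); last by rewrite /cv /cr; lia.
have vec_cost k Z' : (k <= M)%N -> (Z' <= Z)%N -> (k * (cost_rat Z').+1 <= cv)%N.
  exact: cost_vec_le.
have fold k v s : (k <= M)%N -> @rvec k H v s ->
    runs cv (israt V (\big[Num.max/0]_i v i)) (cfold qmax qzero s).
  move=> kM hs; apply: runs_le (runs_sub (cfold_qmax hs H2) _) (vec_cost _ _ kM HZ) => z hz.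
  exact: israt_le hz HV.
have max q r x y : israt V q x -> israt V r y ->
    runs cr (israt V (Num.max q r)) (qmax x y).
  move=> hx hy; apply: runs_le (qmax_spec hx hy) _.
  by apply: cost_rat_le; lia.
apply: runs_bind (runs_le (cmap_qabs Z rb) (vec_cost _ _ mM (leqnn _))) _ => ab hab.
apply: runs_bind (fold _ _ _ mM hab) _ => d1 hd1.
apply: runs_bind (fold _ _ _ nM rl) _ => d2 hd2.
apply: runs_bind (runs_le (cmap_qopp Z rc) (vec_cost _ _ nM (leqnn _))) _ => nc hnc.
apply: runs_bind (fold _ _ _ nM hnc) _ => d3 hd3.
apply: runs_bind (runs_le (cmap_qopp Z rl) (vec_cost _ _ nM (leqnn _))) _ => nl hnl.
apply: runs_bind (bdot_spec hnl rc nM _) _ => [|s hs]; first by rewrite /V in ZV; lia.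
have hs' : israt V (\sum_i - hl i 0 * hc i 0) s by apply: israt_le hs _; rewrite /V; lia.
have H4 : runs cr (israt V `|\sum_i - hl i 0 * hc i 0|) (qabs s).
  by apply: runs_le (qabs_spec hs') _; rewrite /cr /cost_rat addn2.
apply: runs_bind H4 _ => d4 hd4.
apply: runs_bind (max _ _ _ _ hd3 hd4) _ => d34 hd34.
apply: runs_bind (max _ _ _ _ hd2 hd34) _ => d234 hd234.
exact: max.
Qed.

Definition cost_call p M S :=
  (M * (M * (cost_round p S).+1).+1 + 3 * (M * (cost_round p S).+1) + 1)%N.

(** The oracle sees exactly the rounded data, so that its answer is the one
    that the exact algorithm receives. *)
Lemma bcall_spec O p m n S M (A : 'M_(m, n)) (b : 'cV_m) (l c : 'cV_n) sA sb sl sc :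
  rmat S A sA -> rcol S b sb -> rcol S l sl -> rcol S c sc ->
  (m <= M)%N -> (n <= M)%N ->
  runs (cost_call p M S)
    (fun r => r = omap (fun xy => (enc_vec xy.1, enc_vec xy.2)) (call O p A b l c))
    (bcall O p m n sA sb sl sc).
Proof.
move=> [sizeA hA] hb hl hc mM nM; pose cr := (M * (cost_round p S).+1)%N.
have round k v s : (k <= M)%N -> @rvec k S v s ->
    runs cr (fun r => size r = k /\ forall i : 'I_k, dec_rat (nth qzero r i) = round_F p (v i))
      (cmap (qround p) s).
  move=> kM [sk hs]; apply: (@runs_le _ (k * (cost_round p S).+1)).
    pose P (i : 'I_k) z := dec_rat z = round_F p (v i).
    have := @runs_cmap _ _ _ qzero qzero (cost_round p S) P (qround p) s sk.
    by apply=> i; apply: qround_spec (hs i).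
  by rewrite leq_mul2r kM orbT.
have dec k (v : 'cV_k) r : (forall i : 'I_k, dec_rat (nth qzero r i) = round_F p (v i 0)) ->
    dec_vec k r = map_mx (round_F p) v.
  by move=> h; apply/colP => i; rewrite !mxE h.
apply: (@runs_le _ (M * cr.+1 + (cr + (cr + (cr + 1))))); last first.
  by rewrite /cost_call -/cr; lia.
pose PA (i : 'I_m) (r : bvec) := size r = n /\
  forall j : 'I_n, dec_rat (nth qzero r j) = round_F p (A i j).
have HA : runs (M * cr.+1)
    (fun r => size r = m /\ forall i : 'I_m, PA i (nth [::] r i))
    (cmap (cmap (qround p)) sA).
  apply: (@runs_le _ (m * cr.+1)); last by rewrite leq_mul2r mM orbT.
  have := @runs_cmap _ _ _ [::] [::] cr PA (cmap (qround p)) sA sizeA.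
  by apply=> i; apply: round nM (hA i).
apply: runs_bind HA _ => rA [_ hrA].
apply: runs_bind (round _ _ _ mM hb) _ => rb [_ hrb].
apply: runs_bind (round _ _ _ nM hl) _ => rl [_ hrl].
apply: runs_bind (round _ _ _ nM hc) _ => rc [_ hrc].
apply: runs_tick; apply: runs_ret; rewrite /call (dec _ _ _ hrb) (dec _ _ _ hrl) (dec _ _ _ hrc).
suff -> : dec_mat m n rA = map_mx (round_F p) A by [].
by apply/matrixP => i j; rewrite !mxE; case: (hrA i) => _ ->.
Qed.

(** * Violations, exponents and input size *)

Lemma violation_lt m n (t : rat) (hb : 'cV_m) (hl hc : 'cV_n) :
  0 < t -> (forall j, `|hb j 0| < t) -> (forall i, hl i 0 < t) ->
  (forall i, - hc i 0 < t) -> `|\sum_i hl i 0 * hc i 0| < t ->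
  violation hb hl hc < t.
Proof.
move=> t0 h1 h2 h3 h4; have h4' : `|\sum_i - hl i 0 * hc i 0| < t.
  by under eq_bigr do rewrite mulNr; rewrite sumrN normrN.
by rewrite /violation !gt_max h4' !bigmax_lt.
Qed.

Lemma norm_max_ge m (v : 'cV_m) j : `|v j 0| <= norm_max v.
Proof. exact: (@le_bigmax _ _ _ _ (fun i => `|v i 0|)). Qed.

(** Here w is the inverse of the scaling factor.  The residuals of the
    new iterate are w times those of the scaled problem, which are below 1 because
    eta < 1; the complementarity product is scaled by w ^ 2 <= w, and sigma < 1. *)
Lemma violation_after_call (R : archiRealFieldType) p (eta sigma : R) O m n
    (A : 'M_(m, n)) (b : 'cV_m) (l c : 'cV_n) x y (w : rat) :
  eta < 1 -> sigma < 1 -> limited_precision p eta sigma O ->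
  0 < w <= 1 -> call O p A (w^-1 *: b) (w^-1 *: l) (w^-1 *: c) = Some (x, y) ->
  violation (b - w *: (A *m x)) (l - w *: x) (c - w *: (A^T *m y)) < w.
Proof.
move=> eta1 sigma1 HO /andP[w0 w1] /HO[_ hb hl hc hs].
have wK (q r : rat) : q - w * r = w * (w^-1 * q - r).
  by rewrite mulrBr mulVKf // gt_eqF.
apply: violation_lt => //.
- move=> j; have lt1 : norm_max (A *m x - w^-1 *: b) < 1.
    by rewrite -(ltr_rat R) rmorph1; apply: le_lt_trans eta1.
  rewrite !mxE wK normrM gtr0_norm // gtr_pMr //.
  apply: le_lt_trans lt1; rewrite distrC.
  by apply: le_trans (norm_max_ge _ j); rewrite !mxE.
- move=> i; rewrite !mxE wK gtr_pMr // -(ltr_rat R) rmorph1 rmorphB /=.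
  by have := hl i; rewrite !mxE; lra.
- move=> i; rewrite !mxE wK -mulrN gtr_pMr // -(ltr_rat R) rmorph1 rmorphN /=.
  by have := hc i; rewrite !mxE; lra.
have {}hs : `|((x - w^-1 *: l)^T *m (w^-1 *: c - A^T *m y)) 0 0| < 1.
  by rewrite -(ltr_rat R) rmorph1; apply: le_lt_trans sigma1.
have -> : \sum_i (l - w *: x) i 0 * (c - w *: (A^T *m y)) i 0 =
    - (w * w) * ((x - w^-1 *: l)^T *m (w^-1 *: c - A^T *m y)) 0 0.
  rewrite [in RHS]mxE mulr_sumr; apply: eq_bigr => i _.
  rewrite ![in LHS]mxE !wK -[x - _ *: l]opprB ![in RHS]mxE.
  by ring.
rewrite mulNr normrN normrM ger0_norm ?mulr_ge0 ?ltW //.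
rewrite -mulrA gtr_pMr //; apply: le_lt_trans hs.
by rewrite ler_piMl.
Qed.

(** The bound on delta makes the inverse of the maximum larger than 2 ^ e, so
    its ceiling logarithm is at least e + 1; conversely that inverse is at most
    alpha 2 ^ e, and alpha < 2 ^ alpha. *)
Lemma exponent_step alpha e (delta : rat) : (2 <= alpha)%N ->
  delta < (2 ^+ e)^-1 ->
  exists e', ceil_log2 (Num.max delta (alpha%:R * 2 ^+ e)^-1)^-1 = Posz e' /\
             (e < e' <= e + alpha)%N.
Proof.
move=> alpha2 dlt; set d' := Num.max _ _.
have E0 : 0 < 2 ^+ e :> rat by rewrite exprn_gt0.
have a1 : 1 < alpha%:R :> rat by rewrite ltr1n.
have aE0 : 0 < alpha%:R * 2 ^+ e :> rat by rewrite mulr_gt0 // (lt_trans _ a1).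
have d'0 : 0 < d' by rewrite lt_max invr_gt0 aE0 orbT.
have d'lt : d' < (2 ^+ e)^-1.
  by rewrite gt_max dlt ltf_pV2 ?posrE // ltr_pMl.
have lo : 2 ^+ e < d'^-1 by rewrite -[ltLHS]invrK ltf_pV2 ?posrE ?invr_gt0.
have hi : d'^-1 <= alpha%:R * 2 ^+ e.
  by rewrite -[leRHS]invrK lef_pV2 ?posrE ?invr_gt0 // le_max lexx orbT.
have /andP[clo chi] : 2 ^ (ceil_log2 d'^-1 - 1) < d'^-1 <= 2 ^ ceil_log2 d'^-1.
  by apply: ceil_log2P; rewrite invr_gt0.
set k := ceil_log2 _ in clo chi *.
have two : 1 < 2 :> rat by [].
have ek : (e : int) < k.
  by rewrite -(ltr_eXz2l two) -exprnP; apply: lt_le_trans lo chi.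
have ke : k - 1 < (e + alpha)%N.
  rewrite -(ltr_eXz2l two) -exprnP exprD; apply: lt_le_trans clo (le_trans hi _).
  by rewrite mulrC ler_pM2l // -natrX ler_nat ltnW // ltn_expl.
by clear -ek ke; exists `|k|%N; split; lia.
Qed.

(** A positive rational is at least the inverse of its denominator. *)
Lemma exponent_lt_rat_size (tau : rat) e :
  0 < tau -> tau < (2 ^+ e)^-1 -> (e < rat_size tau)%N.
Proof.
move=> t0; have E0 : 0 < 2 ^+ e :> rat by rewrite exprn_gt0.
rewrite -(ltr_pM2r E0) mulVf ?gt_eqF // => lt1.
have d0 : 0 < (denq tau)%:~R :> rat by rewrite ltr0z denq_gt0.
have lt2 : (2 ^ e < `|denq tau|)%N.
  rewrite -(ltr_nat rat) natrX natr_absz (gtr0_norm (denq_gt0 tau)).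
  have n1 : 1 <= (numq tau)%:~R :> rat.
    by rewrite ler1z -gtz0_ge1 numq_gt0.
  move: lt1; rewrite -[X in X * _]divq_num_den mulrAC ltr_pdivrMr // mul1r.
  by apply: le_lt_trans; rewrite ler_peMl // ltW.
have : (2 ^ e < 2 ^ up_log 2 (`|denq tau| + 1))%N.
  by apply: leq_trans lt2 (leq_trans (leq_addr 1 _) (up_logP _ _)).
by rewrite ltn_exp2l // /rat_size /int_size; lia.
Qed.

Lemma rvec_enc n S (v : 'cV_n) :
  (forall i, israt S (v i 0) (enc_rat (v i 0))) -> rcol S v (enc_vec v).
Proof.
move=> h; split; first by rewrite size_map size_enum_ord.
by move=> i; rewrite (nth_map i) ?size_enum_ord // nth_ord_enum.
Qed.

Lemma rmat_enc m n S (A : 'M_(m, n)) :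
  (forall i j, israt S (A i j) (enc_rat (A i j))) -> rmat S A (enc_mat A).
Proof.
move=> h; split; first by rewrite size_map size_enum_ord.
move=> i; rewrite (nth_map i) ?size_enum_ord // nth_ord_enum.
split; first by rewrite size_map size_enum_ord.
by move=> j; rewrite (nth_map j) ?size_enum_ord // nth_ord_enum.
Qed.

Lemma dec_rvec n S (v : 'cV_n) s : rcol S v s -> dec_vec n s = v.
Proof. by case=> _ h; apply/colP => i; rewrite mxE; case: (h i). Qed.

Lemma rat_size_le_mx m n (A : 'M_(m, n)) i j : (rat_size (A i j) <= mx_size A)%N.
Proof.
rewrite /mx_size (bigD1 i) //= (bigD1 j) //= -addnA; exact: leq_addr.
Qed.

Lemma height_le_mx_size m (b : 'cV_m) : (m <= mx_size b)%N.
Proof.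
apply: (@leq_trans (\sum_(i < m) 1)); first by rewrite sum1_card card_ord.
by apply: leq_sum => i _; rewrite big_ord1.
Qed.

(** * The refinement loop *)

Local Open Scope nat_scope.

(** Length bound for a scaling factor 2 ^ e with e <= alpha (N + 1). *)
Definition size_expo alpha N := alpha * N.+1 + 2.

(** Length bound for an iterate: a sum of at most N + 1 oracle answers, each
    divided by a scaling factor. *)
Definition size_iter p alpha N := (2 * p + 2 + size_expo alpha N) * N.+1.

(** Length bound for the entries of the residuals b - A x, l - x and
    c - A^T y. *)
Definition size_resid p alpha N :=
  N + size_iter p alpha N + (2 + N * (N + size_iter p alpha N)).

(** Length bound for the violation, whose longest part is the inner product of
    two residuals. *)
Definition size_viol p alpha N :=
  2 + size_resid p alpha N + N * (size_resid p alpha N + size_resid p alpha N).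

(** At least S + T for every operation of a round on fractions with [israt S] and
    [israt T]. *)
Definition size_operand p alpha N :=
  4 * (size_viol p alpha N + size_expo alpha N + alpha + p + N + 4).

Definition cost_iteration p alpha N :=
  let cv := cost_vec N (size_operand p alpha N) in
  let cr := cost_rat (size_operand p alpha N) in
  17 * cv + 2 * (N * (2 * cv).+1) + 8 * cr + 2 +
  cost_call p N (size_expo alpha N + size_resid p alpha N).

Local Open Scope ring_scope.

Lemma refine_loop_stop O p alpha m n (A : 'M_(m, n)) b l c tau fuel calls x y D :
  violation (b - A *m x) (l - x) (c - A^T *m y) <= tau ->
  refine_loop O p alpha A b l c tau fuel.+1 calls x y D = Some (calls, Returned (x, y)).
Proof. by move=> h; cbn [refine_loop]; rewrite h. Qed.

Lemma refine_loop_abort O p alpha m n (A : 'M_(m, n)) b l c tau fuel calls x y D D' :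
  (violation (b - A *m x) (l - x) (c - A^T *m y) <= tau) = false ->
  2 ^ ceil_log2 (Num.max (violation (b - A *m x) (l - x) (c - A^T *m y))
                         (alpha%:R * D)^-1)^-1 = D' ->
  call O p A (D' *: (b - A *m x)) (D' *: (l - x)) (D' *: (c - A^T *m y)) = None ->
  refine_loop O p alpha A b l c tau fuel.+1 calls x y D = Some (calls.+1, Aborted).
Proof. by move=> h1 h2 h3; cbn [refine_loop]; rewrite h1 h2 h3. Qed.

Lemma refine_loop_next O p alpha m n (A : 'M_(m, n)) b l c tau fuel calls x y D D' hx hy :
  (violation (b - A *m x) (l - x) (c - A^T *m y) <= tau) = false ->
  2 ^ ceil_log2 (Num.max (violation (b - A *m x) (l - x) (c - A^T *m y))
                         (alpha%:R * D)^-1)^-1 = D' ->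
  call O p A (D' *: (b - A *m x)) (D' *: (l - x)) (D' *: (c - A^T *m y))
    = Some (hx, hy) ->
  refine_loop O p alpha A b l c tau fuel.+1 calls x y D =
  refine_loop O p alpha A b l c tau fuel calls.+1
    (x + D'^-1 *: hx) (y + D'^-1 *: hy) D'.
Proof. by move=> h1 h2 h3; cbn [refine_loop]; rewrite h1 h2 h3. Qed.

Definition loop_agrees O p alpha m n (A : 'M_(m, n)) b l c tau fuel calls x y D
    (N : nat) (res : option (nat * outcome (bvec * bvec))) : Prop :=
  exists k r br,
    [/\ refine_loop O p alpha A b l c tau fuel calls x y D = Some (k, r),
        res = Some (k, br), dec_outcome m n br = r & (k <= N.+1)%N].

(** After k rounds the scaling factor is 2 ^ e with k <= e <= alpha k, the
    violation is below 2 ^ - e, and the iterates have length linear in k + 1.  A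
    round that does not stop has e < N by the size of tau, so k + 1 <= N and the
    fuel N + 1 - k never runs out. *)
Lemma brefine_loop_spec (R : archiRealFieldType) p (eta sigma : R) O alpha m n
    (A : 'M_(m, n)) (b : 'cV_m) (l c : 'cV_n) tau sA sb sl sc btau N :
  eta < 1 -> sigma < 1 -> limited_precision p eta sigma O -> (2 <= alpha)%N ->
  0 < tau -> (rat_size tau <= N)%N -> (m <= N)%N -> (n <= N)%N ->
  rmat N A sA -> rcol N b sb -> rcol N l sl -> rcol N c sc -> israt N tau btau ->
  forall fuel k e x y sx sy bD, (k + fuel = N.+1)%N -> (k <= N)%N ->
  (k <= e <= alpha * k)%N ->
  violation (b - A *m x) (l - x) (c - A^T *m y) < (2 ^+ e)^-1 ->
  rcol ((2 * p + 2 + size_expo alpha N) * k.+1) x sx ->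
  rcol ((2 * p + 2 + size_expo alpha N) * k.+1) y sy ->
  israt (e + 2) (2 ^+ e) bD ->
  runs (fuel * (cost_iteration p alpha N).+1)
    (loop_agrees O p alpha A b l c tau fuel k.+1 x y (2 ^+ e) N)
    (brefine_loop O p alpha m n sA sb sl sc btau fuel k.+1 sx sy bD).
Proof.
move=> eta1 sigma1 HO alpha2 tau0 tauN mN nN hA hb hl hc htau.
elim=> [|fuel IH] k e x y sx sy bD kfuel kN /andP[ke ek] viol hx hy hD.
  by move: kN; rewrite addn0 in kfuel; rewrite kfuel ltnn.
set Z := size_operand p alpha N; set cv := cost_vec N Z; set cr := cost_rat Z.
set X := size_iter p alpha N; set H := size_resid p alpha N.
set V := size_viol p alpha N; set E := size_expo alpha N.
have eE : (e + 2 <= E)%N.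
  by rewrite leq_add2r (leq_trans ek) // leq_mul2l ltnW ?orbT.
have XE : ((2 * p + 2 + E) * k.+1 <= X)%N by rewrite leq_mul2l ltnS kN orbT.
have ZE : Z = (4 * (V + E + alpha + p + N + 4))%N by [].
have VE : V = (2 + H + N * (H + H))%N by [].
have HE : H = (N + X + (2 + N * (N + X)))%N by [].
have EX : (2 * p + 2 + E <= X)%N by apply: leq_pmulr.
have HV : (H <= V)%N by rewrite VE -addnA addnCA leq_addr.
have NXH : (N + X <= H)%N by rewrite HE leq_addr.
have HZ : (4 * (H + E + p + N + alpha + 4) <= Z)%N by rewrite ZE; size_lia.
have XZ : (4 * (X + E + p + N + alpha + 4) <= Z)%N by size_lia.
have XZ' : ((2 * p + 2 + E) * k.+2 <= Z)%N by size_lia.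
have rx := rvec_le hx XE; have ry := rvec_le hy XE.
have vec_cost k' Z' : (k' <= N)%N -> (Z' <= Z)%N -> (k' * (cost_rat Z').+1 <= cv)%N.
  exact: cost_vec_le.
pose cm := (N * (2 * cv).+1)%N.
pose cc := cost_call p N (E + H).
(* The summands follow the steps of a round; cm is the cost of a product with A
   or with its transpose. *)
apply: (@runs_le _ ((cm + cv) + (cv + (cm + ((8 * cv + 4 * cr) + (cr + (cr + (1 + (cr +
  (cr + (cv + (cv + (cv + (cc + (1 + (cv + (cv + (cv + (cv +
   fuel * (cost_iteration p alpha N).+1)))))))))))))))))).+1); last first.
  by rewrite mulSn /cost_iteration -/Z -/cv -/cr -/cm -/E -/H -/cc; size_lia.
cbn [brefine_loop]; apply: runs_tick.
set hbv := b - A *m x; set hlv := l - x; set hcv := c - A^T *m y.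
set delta := violation hbv hlv hcv.
have Hb : runs (cm + cv) (rcol H hbv) (bresidual sA sb sx).
  apply: runs_sub (bresidual_spec (Z := Z) hA hb rx mN nN _) _ => [|r hr].
    by rewrite ZE VE HE; size_lia.
  by apply: rvec_le hr _; rewrite HE; size_lia.
apply: runs_bind Hb _ => hb' rb.
have Hl : runs cv (rcol H hlv) (cmap2 qsub sl sx).
  apply: runs_le (runs_sub (cmap2_qsub hl rx) _) (vec_cost _ _ nN _) => [r hr|]; last by size_lia.
  by apply: rvec_le (rvec_ext hr _) NXH => i; rewrite !mxE.
apply: runs_bind Hl _ => hl' rl.
have Hc : runs cm (rcol H hcv) (breduced sA sc sy).
  case: (hA) => sizeA hA'.
  apply: runs_le (runs_sub (breduced_spec (Z := Z) sizeA hA' hc ry mN nN _) _) _ => [|r hr|].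
  - by rewrite ZE VE HE; size_lia.
  - have hr' := rvec_ext hr (_ : _ =1 fun i => hcv i 0).
    apply: rvec_le (hr' _) _ => [i|].
      by rewrite !mxE; congr (_ - _); apply: eq_bigr => j _; rewrite mxE.
    have : (m * (N + X) <= N * (N + X))%N by rewrite leq_mul2r mN orbT.
    by rewrite HE; size_lia.
  by rewrite leq_mul2r mN orbT.
apply: runs_bind Hc _ => hc' rc.
have Hv : runs (8 * cv + 4 * cr) (israt V delta) (bviolation hb' hl' hc').
  by apply: bviolation_spec => //; rewrite ?VE ?HE; size_lia.
apply: runs_bind Hv _ => bdelta hdelta.
have Hstop : runs cr (fun s => s = (delta <= tau)) (qleq bdelta btau).
  by apply: runs_le (qleq_spec hdelta htau) _; apply: cost_rat_le; size_lia.
apply: runs_bind Hstop _ => _ ->.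
case stop: (delta <= tau).
  apply: runs_ret; exists k.+1, (Returned (x, y)), (Returned (sx, sy)).
  by split=> //; [exact: refine_loop_stop | rewrite /= (dec_rvec hx) (dec_rvec hy)].
(* A round that does not stop has tau < delta < 2 ^ - e. *)
have eN : (e < N)%N.
  apply: leq_trans (exponent_lt_rat_size tau0 _) tauN.
  by apply: lt_trans viol; rewrite ltNge -/hbv -/hlv -/hcv -/delta stop.
have k1N : (k.+1 <= N)%N by apply: leq_ltn_trans eN.
have [e' [ceE /andP[ee' e'e]]] := exponent_step alpha2 viol.
have E0 : 0 < 2 ^+ e :> rat by rewrite exprn_gt0.
have a0 : 0 < alpha%:R :> rat by rewrite ltr0n ltnW.
have ek' : (e' <= alpha * k.+1)%N by rewrite mulnS; size_lia.
have e'E : (e' + 2 <= E)%N.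
  by rewrite leq_add2r (leq_trans ek') // leq_mul2l ltnW ?orbT.
have halpha : israt (alpha + 2) alpha%:R (BRat false (nat_bits alpha) [:: true]).
  split; rewrite /= ?canon_nat_bits //; last 2 first.
  - by rewrite addn2.
  - by rewrite /dec_rat /= bits_val_nat_bits mul1r divr1.
  by rewrite addn2 ltnS ltnW // ltnS; apply: size_nat_bits_le; rewrite ltn_expl.
have HaD : runs cr (israt (alpha + 2 + (e + 2)) (alpha%:R * 2 ^+ e))
    (qmul (BRat false (nat_bits alpha) [:: true]) bD).
  by apply: runs_le (qmul_spec halpha hD) _; apply: cost_rat_le; size_lia.
apply: runs_bind HaD _ => aD haD.
have aD0 : 0 < alpha%:R * 2 ^+ e :> rat by rewrite mulr_gt0.
apply: runs_bind (qinv_spec _ haD) _ => [|iaD hiaD]; first by rewrite gt_eqF.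
set delta' := Num.max delta _ in ceE.
have hdelta2 := israt_le hdelta (leq_addr (alpha + E + 2) V).
have hiaD2 := israt_le hiaD (_ : _ <= V + (alpha + E + 2))%N.
have Hmax : runs cr (israt (V + (alpha + E + 2)) delta') (qmax bdelta iaD).
  apply: runs_le (qmax_spec hdelta2 (hiaD2 _)) _; first by size_lia.
  by apply: cost_rat_le; size_lia.
apply: runs_bind Hmax _ => bdelta' hdelta'.
have d'0 : 0 < delta' by rewrite lt_max invr_gt0 aD0 orbT.
have HD' : runs cr (israt (e' + 2) (2 ^+ e')) (qpow2 bdelta').
  by apply: runs_le (qpow2_spec hdelta' d'0 ceE) _; apply: cost_rat_le; size_lia.
apply: runs_bind HD' _ => bD' hD'.
(* Of delta only the exponent e' enters the lengths of the scaled data and of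
   the next iterate. *)
have HD'E := israt_le hD' e'E.
have scale k' (v : 'cV_k') s : (k' <= N)%N -> rcol H v s ->
    runs cv (rcol (E + H) (2 ^+ e' *: v)) (bscale bD' s).
  move=> k'N hs; apply: runs_le (runs_sub (bscale_spec HD'E hs) _) (vec_cost _ _ k'N _) =>
    [r hr|].
    by apply: rvec_ext hr _ => i; rewrite mxE.
  by size_lia.
apply: runs_bind (scale _ _ _ mN rb) _ => sb' hsb.
apply: runs_bind (scale _ _ _ nN rl) _ => sl' hsl.
apply: runs_bind (scale _ _ _ nN rc) _ => sc' hsc.
have hA2 : rmat (E + H) A sA.
  by case: hA => sizeA h; split=> // i; apply: rvec_le (h i) _; size_lia.
apply: runs_bind (bcall_spec O p hA2 hsb hsl hsc mN nN) _ => _ ->.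
have D'E : 2 ^ ceil_log2 delta'^-1 = 2 ^+ e' :> rat by rewrite ceE.
case callE: (call _ _ _ _ _ _) => [[ox oy]|] /=; last first.
  apply: runs_ret; exists k.+2, Aborted, Aborted; split=> //.
  exact: refine_loop_abort stop D'E callE.
have D'0 : 0 < 2 ^+ e' :> rat by rewrite exprn_gt0.
apply: runs_bind (qinv_spec _ hD') _ => [|iD hiD]; first by rewrite gt_eqF.
have [[Fx Fy] _ _ _ _] := HO _ _ _ _ _ _ _ _ callE.
have hw k' (w : 'cV_k') : (k' <= N)%N -> (forall i, in_F p (w i 0)) ->
    runs cv (rcol (2 * p + 2 + E) ((2 ^+ e')^-1 *: w)) (bscale iD (enc_vec w)).
  move=> k'N Fw; have henc := rvec_enc (fun i => israt_enc_F (Fw i)).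
  apply: runs_le (runs_sub (bscale_spec hiD henc) _) (vec_cost _ _ k'N _) => [r hr|].
    by apply: rvec_le (rvec_ext hr _) _ => [i|]; rewrite ?mxE // addnC leq_add2l.
  by size_lia.
have hv k' (v w : 'cV_k') s t : (k' <= N)%N ->
    rcol ((2 * p + 2 + E) * k.+1) v s -> rcol (2 * p + 2 + E) w t ->
    runs cv (rcol ((2 * p + 2 + E) * k.+2) (v + w)) (cmap2 qadd s t).
  move=> k'N hs ht; rewrite [((_ + E) * k.+2)%N]mulnS addnC.
  apply: runs_le (runs_sub (cmap2_qadd hs ht) _) (vec_cost _ _ k'N _) => [r hr|].
    by apply: rvec_ext hr _ => i; rewrite !mxE.
  by rewrite addnC -mulnS; apply: leq_trans (leq_mul (leqnn _) _) XZ'.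
apply: runs_bind (hw _ _ nN Fx) _ => dx hdx.
apply: runs_bind (hv _ _ _ _ _ nN hx hdx) _ => x' hx'.
apply: runs_bind (hw _ _ mN Fy) _ => dy hdy.
apply: runs_bind (hv _ _ _ _ _ mN hy hdy) _ => y' hy'.
have viol' : violation (b - A *m (x + (2 ^+ e')^-1 *: ox))
    (l - (x + (2 ^+ e')^-1 *: ox))
    (c - A^T *m (y + (2 ^+ e')^-1 *: oy)) < (2 ^+ e')^-1.
  rewrite !mulmxDr -!scalemxAr !opprD !addrA.
  apply: violation_after_call eta1 sigma1 HO _ _; last by rewrite invrK.
  by rewrite invr_gt0 D'0 invf_le1 // exprn_ege1 // ler1n.
have kfuel' : (k.+1 + fuel = N.+1)%N by rewrite addSnnS.
have ke' : (k.+1 <= e' <= alpha * k.+1)%N by rewrite ek' andbT (leq_ltn_trans ke).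
apply: runs_sub (IH _ _ _ _ _ _ _ kfuel' k1N ke' viol' hx' hy' hD') _.
move=> res [calls [r [br [rE bE dE cE]]]]; exists calls, r, br; split=> //.
by rewrite (refine_loop_next _ _ stop D'E callE).
Qed.

(** * Polynomial bounds *)

Local Open Scope nat_scope.

(** The explicit cost bounds are built from additions and multiplications
    only, so they are polynomials and not merely bounded by polynomials. *)
Definition polynomial_fun (f : nat -> nat) : Prop :=
  exists P : {poly nat}, forall x, f x = P.[x]%R.

Lemma polynomial_cst k : polynomial_fun (fun=> k).
Proof. by exists (k%:P)%R => x; rewrite hornerC. Qed.

Lemma polynomial_id : polynomial_fun id.
Proof. by exists 'X%R => x; rewrite hornerX. Qed.

Lemma polynomial_add f g : polynomial_fun f -> polynomial_fun g ->
  polynomial_fun (fun x => f x + g x).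
Proof. by move=> [P fP] [Q gQ]; exists (P + Q)%R => x; rewrite hornerD fP gQ. Qed.

Lemma polynomial_mul f g : polynomial_fun f -> polynomial_fun g ->
  polynomial_fun (fun x => f x * g x).
Proof. by move=> [P fP] [Q gQ]; exists (P * Q)%R => x; rewrite hornerM fP gQ. Qed.

Lemma polynomial_succ f : polynomial_fun f -> polynomial_fun (fun x => (f x).+1).
Proof.
by move=> [P fP]; exists (P + 1)%R => x; rewrite hornerD hornerC fP -addn1.
Qed.

Ltac polynomial :=
  cbv beta zeta;
  lazymatch goal with
  | |- polynomial_fun (fun=> ?k) => exact (polynomial_cst k)
  | |- polynomial_fun (fun x => x) => exact polynomial_id
  | |- polynomial_fun (fun x => addn (@?f x) (@?g x)) =>
      refine (@polynomial_add f g _ _); polynomial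
  | |- polynomial_fun (fun x => muln (@?f x) (@?g x)) =>
      refine (@polynomial_mul f g _ _); polynomial
  | |- polynomial_fun (fun x => S (@?f x)) =>
      refine (@polynomial_succ f _); polynomial
  | _ => eassumption
  end.

Lemma polynomial_cost_rat f : polynomial_fun f -> polynomial_fun (fun x => cost_rat (f x)).
Proof. by move=> fP; rewrite /cost_rat /cost_mul /cost_norm /cost_divmod; polynomial. Qed.

Lemma polynomial_cost_call p f : polynomial_fun f ->
  polynomial_fun (fun x => cost_call p x (f x)).
Proof.
by move=> fP; rewrite /cost_call /cost_round /cost_norm /cost_divmod; polynomial.
Qed.

Lemma polynomial_cost_iteration p alpha : polynomial_fun (cost_iteration p alpha).
Proof.
have sE : polynomial_fun (size_expo alpha) by rewrite /size_expo; polynomial.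
have sX : polynomial_fun (size_iter p alpha) by rewrite /size_iter; polynomial.
have sH : polynomial_fun (size_resid p alpha) by rewrite /size_resid; polynomial.
have sV : polynomial_fun (size_viol p alpha) by rewrite /size_viol; polynomial.
have sR : polynomial_fun (size_operand p alpha) by rewrite /size_operand; polynomial.
have cr := polynomial_cost_rat sR.
have cc := polynomial_cost_call p (polynomial_add sE sH).
by rewrite /cost_iteration /cost_vec; polynomial.
Qed.

Local Open Scope ring_scope.

Theorem theorem3 (R : archiRealFieldType) (p alpha : nat) (eta sigma : R)
    (heta : 0 < eta < 1) (hsigma : 0 < sigma) (hsigma1 : sigma < 1)
    (halpha : (2 <= alpha)%N) :
  exists P Q : {poly nat},
  forall O : lp_oracle, limited_precision p eta sigma O ->
  forall (m n : nat) (A : 'M[rat]_(m, n)) (b : 'cV[rat]_m) (l c : 'cV[rat]_n)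
    (tau : rat),
    (m <= n)%N -> row_free A -> 0 < tau ->
    let N := input_size A b l c tau in
    exists (fuel calls bitops : nat) (r : outcome ('cV[rat]_n * 'cV[rat]_m))
      (br : outcome (bvec * bvec)),
      [/\ refine O p alpha A b l c tau fuel = Some (calls, r),
          brefine O p alpha m n (enc_mat A) (enc_vec b) (enc_vec l) (enc_vec c)
            (enc_rat tau) fuel = (bitops, Some (calls, br)),
          dec_outcome m n br = r,
          (calls <= P.[N])%N
        & (bitops <= Q.[N])%N].
Proof.
have /andP[_ eta1] := heta.
have [Q QE] : polynomial_fun (fun N =>
    cost_call p N N + N.+1 * (cost_iteration p alpha N).+1)%N.
  have ci := polynomial_cost_iteration p alpha.
  have cc := polynomial_cost_call p polynomial_id.
  by polynomial.
exists ('X + 1), Q => O HO m n A b l c tau _ _ tau0 N.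
have NE : N = (mx_size A + mx_size b + mx_size l + mx_size c + rat_size tau)%N by [].
have enc q S : (rat_size q <= S)%N -> (S <= N)%N -> israt N q (enc_rat q).
  by move=> qS SN; apply: israt_le (israt_enc_size q) (leq_trans qS SN).
have mN : (m <= N)%N by have := height_le_mx_size b; lia.
have nN : (n <= N)%N by have := height_le_mx_size l; lia.
have hA : rmat N A (enc_mat A).
  by apply: rmat_enc => i j; apply: enc (rat_size_le_mx A i j) _; lia.
have hb : rcol N b (enc_vec b).
  by apply: rvec_enc => i; apply: enc (rat_size_le_mx b i 0) _; lia.
have hl : rcol N l (enc_vec l).
  by apply: rvec_enc => i; apply: enc (rat_size_le_mx l i 0) _; lia.
have hc : rcol N c (enc_vec c).
  by apply: rvec_enc => i; apply: enc (rat_size_le_mx c i 0) _; lia.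
have tauN : (rat_size tau <= N)%N by lia.
have htau := enc tau _ tauN (leqnn N).
suff [cost [k [r [br [rE bE dE kN]]]]] :
    runs (cost_call p N N + N.+1 * (cost_iteration p alpha N).+1)
      (fun res => exists k r br, [/\ refine O p alpha A b l c tau N.+1 = Some (k, r),
         res = Some (k, br), dec_outcome m n br = r & (k <= N.+1)%N])
      (brefine O p alpha m n (enc_mat A) (enc_vec b) (enc_vec l) (enc_vec c)
         (enc_rat tau) N.+1).
  exists N.+1, k, (brefine O p alpha m n (enc_mat A) (enc_vec b) (enc_vec l)
    (enc_vec c) (enc_rat tau) N.+1).1, r, br; split=> //.
  - by rewrite -bE; apply: surjective_pairing.
  - by rewrite hornerD hornerX hornerC -[(N + 1)%R]/(N + 1)%N addn1.
  - by rewrite -QE.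
rewrite /refine; apply: runs_bind (bcall_spec O p hA hb hl hc mN nN) _ => _ ->.
case callE: (call _ _ _ _ _ _) => [[x y]|] /=; last first.
  by apply: runs_ret; exists 1%N, Aborted, Aborted.
have [[Fx Fy] _ _ _ _] := HO _ _ _ _ _ _ _ _ callE.
have hF k (w : 'cV_k) : (forall i, in_F p (w i 0)) ->
    rcol ((2 * p + 2 + size_expo alpha N) * 1) w (enc_vec w).
  move=> Fw; have henc := rvec_enc (fun i => israt_enc_F (Fw i)).
  by apply: rvec_le henc _; rewrite muln1 leq_addr.
have viol : violation (b - A *m x) (l - x) (c - A^T *m y) < (2 ^+ 0)^-1.
  rewrite expr0 invr1 -[A *m x]scale1r -[in l - _](scale1r x) -[A^T *m y]scale1r.
  apply: violation_after_call eta1 hsigma1 HO _ _; first by rewrite ltr01 lexx.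
  by rewrite invr1 !scale1r.
have := brefine_loop_spec eta1 hsigma1 HO halpha tau0 tauN mN nN hA hb hl hc htau.
by move=> /(_ N.+1 0 0)%N /(_ _ _ _ _ qone erefl isT isT viol (hF _ _ Fx) (hF _ _ Fy));
  apply; exact: (israt_bpow2 0).
Qed.
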